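(* Let $X$ be a discrete metric space of bounded geometry. For every rank distribution $\mathcal{R}$ on $X$, the set $\tilde I(\mathcal{R})=\{T\in C^*(X):\mathrm{RANK}(T_\varepsilon)\in\mathcal{R}\text{ for any }\varepsilon>0\}$ is an ideal in the Roe algebra $C^*(X)$.
   Context: Bounded geometry: for every $r>0$, $\sup_{x\in X}\sharp B(x,r)<\infty$. A subset $E\subseteq X\times X$ is an entourage if $\sup_{(x,y)\in E}d(x,y)<\infty$. Roe algebra: Fix a separable infinite-dimensional Hilbert space $\mathcal{H}$. Write $T\in\mathfrak{B}(\ell^2(X)\otimes\mathcal{H})$ as a matrix $[T(x,y)]_{x,y\in X}$ with $T(x,y)\in\mathfrak{B}(\mathcal{H})$. $T$ has finite propagation if $\{(x,y):T(x,y)\ne0\}$ is an entourage, and is locally compact if every $T(x,y)$ is compact. $\mathbb{C}[X]$ is the $*$-algebra of locally compact finite propagation operators and $C^*(X)$ is its norm closure. Ideals in $C^*(X)$ are closed and two-sided. Rank distributions: A rank function is a function $\alpha:X\times X\to\mathbb{Z}_{\ge0}$ whose support $\mathrm{supp}(\alpha)=\{(x,y):\alpha(x,y)\neq 0\}$ is an entourage. For an entourage $E$, $(E\cdot\alpha)(x,y)=\sum_{z}\chi_E(x,z)\alpha(z,y)$ and $(\alpha\cdot E)(x,y)=\sum_z\alpha(x,z)\chi_E(z,y)$; $\alpha^t(x,y)=\alpha(y,x)$; sums and the order $\le$ are pointwise. A rank distribution on $X$ is a collection $\mathcal{R}$ of rank functions such that: (i) if $\alpha,\beta\in\mathcal{R}$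 and $E$ is an entourage then $\alpha+\beta,\alpha^t,E\cdot\alpha,\alpha\cdot E\in\mathcal{R}$; (ii) every rank function with finite support is in $\mathcal{R}$; (iii) if $\alpha$ is a rank function with $\alpha\le\beta$ for some $\beta\in\mathcal{R}$ then $\alpha\in\mathcal{R}$. Truncations: a compact operator $S$ on $\mathcal{H}$ has a singular value decomposition $S=\sum_i\lambda_i(S)\,u_i\otimes v_i$, with $(u\otimes v)x=\langle x,v\rangle u$, and for $\varepsilon>0$ its $\varepsilon$-truncation is $S_\varepsilon=\sum_{i:\lambda_i(S)\ge\varepsilon}\lambda_i(S)u_i\otimes v_i$. For $T\in C^*(X)$, $T_\varepsilon$ is the operator with entries $T_\varepsilon(x,y)=T(x,y)_\varepsilon$. If all entries of $T$ have finite rank, $\mathrm{RANK}(T)(x,y)=\mathrm{rank}(T(x,y))$. *)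

(* Defs.v *)
From HB Require Import structures.
From mathcomp Require Import all_boot all_order all_algebra.
From mathcomp Require Import sesquilinear.
From mathcomp Require Import all_classical all_reals all_analysis.
From mathcomp Require Import complex lra.

Set Implicit Arguments.
Unset Strict Implicit.
Unset Printing Implicit Defensive.

Import Order.TTheory GRing.Theory Num.Def Num.Theory.
Import numFieldNormedType.Exports.

Local Open Scope classical_set_scope.
Local Open Scope ring_scope.
Local Open Scope complex_scope.

Section CoarseGeometry.
Context {R : realType} {X : metricType R}.
Implicit Types (E : set (X * X)) (alpha beta : X -> X -> nat).

Definition bounded_geometry : Prop :=
  forall r : R, 0 < r -> exists N : nat, forall x : X, (ball x r #<= `I_N)%card.

(* Not to be confused with the entourages of the uniformity of X. *)
Definition coarse_entourage E : Prop :=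
  exists r : R, forall x y, E (x, y) -> mdist x y <= r.

Definition rank_supp alpha : set (X * X) := [set p | alpha p.1 p.2 != 0%N].

Definition rank_function alpha : Prop := coarse_entourage (rank_supp alpha).

(* If E and supp(alpha) are coarse entourages and X has bounded geometry, the
   sums below have finitely many nonzero terms. *)
Definition entourage_mull E alpha : X -> X -> nat :=
  fun x y => \sum_(z \in [set: X]) (((x, z) \in E) * alpha z y)%N.

Definition entourage_mulr alpha E : X -> X -> nat :=
  fun x y => \sum_(z \in [set: X]) (alpha x z * ((z, y) \in E))%N.

Record rank_distribution (D : set (X -> X -> nat)) : Prop := RankDistribution {
  rkd_rank_function : forall alpha, D alpha -> rank_function alpha;
  rkd_add : forall alpha beta, D alpha -> D beta ->
    D (fun x y => (alpha x y + beta x y)%N);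
  rkd_tr : forall alpha, D alpha -> D (fun x y => alpha y x);
  rkd_mull : forall E alpha, coarse_entourage E -> D alpha ->
    D (entourage_mull E alpha);
  rkd_mulr : forall E alpha, coarse_entourage E -> D alpha ->
    D (entourage_mulr alpha E);
  rkd_finite : forall alpha, rank_function alpha ->
    finite_set (rank_supp alpha) -> D alpha;
  rkd_le : forall alpha beta, rank_function alpha -> D beta ->
    (forall x y, (alpha x y <= beta x y)%N) -> D alpha
}.

End CoarseGeometry.

Arguments bounded_geometry {R} X.

(* A complex Hilbert space is a completeNormedModType over R[i] together with a
   positive definite hermitian form (linear in its first argument) inducing the
   norm. *)

Section HilbertSpace.
Context {R : realType} {H : completeNormedModType R[i]}.
Implicit Types (dot : {dot H for conjC}) (S F : H -> H).

Definition induces_norm dot : Prop := forall x : H, dot x x = `|x| ^+ 2.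

Definition span n (e : 'I_n -> H) : set H :=
  range (fun a : 'I_n -> R[i] => \sum_(i < n) a i *: e i).

Definition lin_indep n (e : 'I_n -> H) : Prop :=
  forall a : 'I_n -> R[i], \sum_(i < n) a i *: e i = 0 -> forall i, a i = 0.

Definition infinite_dimensional : Prop :=
  forall n (e : 'I_n -> H), span e <> setT.

Definition separable : Prop := exists2 D : set H, countable D & dense D.

(* The dimension of the range; 0 by convention if it is infinite. *)
Definition rank F : nat :=
  xget 0%N [set n | exists2 e : 'I_n -> H, lin_indep e & span e = range F].

Definition compact_operator F : Prop := precompact (F @` [set x | `|x| <= 1]).

(* A decomposition with finitely many terms is padded with terms of coefficient
   0, on whose vectors nothing is required. *)
Definition is_svd dot S (s : nat -> R) (u v : nat -> H) : Prop :=
  [/\ forall i, 0 <= s i,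
      s @ \oo --> (0 : R),
      forall i j, s i != 0 -> s j != 0 -> dot (u i) (u j) = (i == j)%:R,
      forall i j, s i != 0 -> s j != 0 -> dot (v i) (v j) = (i == j)%:R &
      forall x, series (fun i => ((s i)%:C * dot x (v i)) *: u i) @ \oo --> S x].

(* For eps > 0 the index set is finite, since s tends to 0. *)
Definition svd_truncation dot (eps : R) (s : nat -> R) (u v : nat -> H) : H -> H :=
  fun x => \sum_(i \in [set i | eps <= s i]) ((s i)%:C * dot x (v i)) *: u i.

(* The truncation of a compact operator does not depend on the choice of the
   singular value decomposition. *)
Definition truncation dot (eps : R) S : H -> H :=
  xget (fun=> 0) [set F | exists s u v, is_svd dot S s u v /\
                                        F = svd_truncation dot eps s u v].

End HilbertSpace.

Arguments infinite_dimensional {R} H.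
Arguments separable {R} H.

Section SquareSummable.
Context {R : realType} {H : completeNormedModType R[i]}.

(* The norm of H takes its values in R[i]. *)
Definition rnorm (h : H) : R := complex.Re `|h|.

Lemma rnormE (h : H) : `|h| = (rnorm h)%:C.
Proof. rewrite /rnorm RRe_real//; exact: ger0_real (normr_ge0 h). Qed.

Lemma rnorm_ge0 (h : H) : 0 <= rnorm h.
Proof. rewrite -(@lecR R) -rnormE; exact: normr_ge0. Qed.

Lemma rnorm0 : rnorm 0 = 0.
Proof. by rewrite /rnorm normr0. Qed.

Lemma ler_rnormD (g h : H) : rnorm (g + h) <= rnorm g + rnorm h.
Proof. by rewrite -lecR rmorphD/= -!rnormE ler_normD. Qed.

Lemma rnormZ (a : R[i]) (h : H) : rnorm (a *: h) = complex.Re `|a| * rnorm h.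
Proof.
by apply: (@complexI R); rewrite rmorphM/= -!rnormE normrZ.
Qed.

Context {X : choiceType}.

Definition sqnorm (f : X -> H) : \bar R :=
  (\esum_(x in [set: X]) (rnorm (f x) ^+ 2)%:E)%E.

Definition square_summable : {pred X -> H} := [pred f | (sqnorm f < +oo)%E].

Lemma sqnorm_pt_ge0 (f : X -> H) x : (0 <= (rnorm (f x) ^+ 2)%:E)%E.
Proof. by rewrite lee_fin sqr_ge0. Qed.

Lemma square_summableZ a (f : X -> H) :
  f \in square_summable -> a *: f \in square_summable.
Proof.
rewrite !inE => foo.
have c0 : 0 <= complex.Re `|a| ^+ 2 by rewrite sqr_ge0.
apply: (@le_lt_trans _ _ ((complex.Re `|a| ^+ 2)%:E * sqnorm f)%E); last first.
  by rewrite lte_mul_pinfty ?lee_fin.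
apply: ge_ereal_sup => _ [A finA <-].
rewrite (eq_fsbigr (fun x =>
    (complex.Re `|a| ^+ 2)%:E * (rnorm (f x) ^+ 2)%:E)%E); last first.
  by move=> x _; rewrite rnormZ exprMn EFinM.
rewrite -ge0_mule_fsumr//; last exact: sqnorm_pt_ge0.
by apply: lee_wpmul2l; [rewrite lee_fin|apply: ereal_sup_ubound; exists A].
Qed.

Lemma square_summableD (f g : X -> H) :
  f \in square_summable -> g \in square_summable -> f + g \in square_summable.
Proof.
move=> /(square_summableZ 2) + /(square_summableZ 2); rewrite !inE => foo goo.
apply: (@le_lt_trans _ _ (sqnorm (2 *: f) + sqnorm (2 *: g))%E); last first.
  by rewrite lte_add_pinfty.
rewrite /sqnorm -esumD; [|by move=> x _; exact: sqnorm_pt_ge0..].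
apply: le_esum => x _; rewrite -EFinD lee_fin.
have r2 (h : H) : rnorm (2 *: h) = 2 * rnorm h.
  by rewrite rnormZ ger0_norm//= addr0.
rewrite !r2; apply: (@le_trans _ _ ((rnorm (f x) + rnorm (g x)) ^+ 2)).
  by rewrite lerXn2r ?nnegrE ?addr_ge0 ?rnorm_ge0 ?ler_rnormD.
have := rnorm_ge0 (f x); have := rnorm_ge0 (g x).
have := sqr_ge0 (rnorm (f x) - rnorm (g x)); nra.
Qed.

Lemma square_summable_submod : submod_closed square_summable.
Proof.
split=> [|a f g fl2 gl2].
  by rewrite inE /sqnorm esum1 ?ltry// => x _; rewrite rnorm0 expr0n.
by apply: square_summableD => //; exact: square_summableZ.
Qed.

HB.instance Definition _ := GRing.isSubmodClosed.Build R[i] (X -> H)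
  square_summable square_summable_submod.

End SquareSummable.

(* The square summable functions X -> H, as a model of l2(X) tensor H. *)
Record l2 (R : realType) (X : choiceType) (H : completeNormedModType R[i]) := L2 {
  l2_val :> X -> H;
  l2_valP : l2_val \in square_summable
}.
Arguments L2 {R X H}.

HB.instance Definition _ (R : realType) (X : choiceType)
    (H : completeNormedModType R[i]) :=
  [isSub for @l2_val R X H].
HB.instance Definition _ (R : realType) (X : choiceType)
    (H : completeNormedModType R[i]) :=
  [Choice of l2 X H by <:].
HB.instance Definition _ (R : realType) (X : choiceType)
    (H : completeNormedModType R[i]) :=
  [SubChoice_isSubLmodule of l2 X H by <:].

Section L2Theory.
Context {R : realType} {X : choiceType} {H : completeNormedModType R[i]}.

Definition l2norm (f : l2 X H) : R := Num.sqrt (fine (sqnorm f)).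

Lemma single_square_summable (y : X) (h : H) :
  (fun x => if x == y then h else 0) \in @square_summable R H X.
Proof.
rewrite inE /sqnorm (_ : esum _ _ = (rnorm h ^+ 2)%:E) ?ltry//.
rewrite -[RHS](@esum_set1 _ _ y (fun=> (rnorm h ^+ 2)%:E)) ?lee_fin ?sqr_ge0//.
rewrite [RHS]esum_mkcond; apply: eq_esum => x _.
by rewrite in_set1; case: eqP => // _; rewrite rnorm0 expr0n.
Qed.

(* delta_y tensor h *)
Definition single (y : X) (h : H) : l2 X H := L2 _ (single_square_summable y h).

End L2Theory.

Notation operator X H := {linear l2 X H -> l2 X H}.

Section Operators.
Context {R : realType} {X : metricType R} {H : completeNormedModType R[i]}.
Implicit Types (S T : operator X H) (M : X -> X -> H -> H).

Definition bounded_operator T : Prop :=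
  exists C : R, forall f, l2norm (T f) <= C * l2norm f.

Definition opnorm T : R := sup [set l2norm (T f) | f in [set f | l2norm f <= 1]].

(* (T f) x is the sum over y of entry T x y (f y). *)
Definition entry T (x y : X) : H -> H := fun h => T (single y h) x.

Definition finite_propagation T : Prop :=
  coarse_entourage [set p : X * X | entry T p.1 p.2 <> (fun=> 0)].

Definition locally_compact_operator T : Prop :=
  forall x y, compact_operator (entry T x y).

Definition algebraic_roe : set (operator X H) :=
  [set T | [/\ bounded_operator T, finite_propagation T &
               locally_compact_operator T]].

Definition norm_closure (A : set (operator X H)) : set (operator X H) :=
  [set T | bounded_operator T /\
    forall eps : R, 0 < eps -> exists2 S, A S & opnorm (T \- S) < eps].

Definition roe_algebra : set (operator X H) := norm_closure algebraic_roe.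

Record closed_ideal (A I : set (operator X H)) : Prop := ClosedIdeal {
  idl_sub : I `<=` A;
  idl_0 : I \0;
  idl_add : forall S T, I S -> I T -> I (S \+ T);
  idl_scale : forall (a : R[i]) T, I T -> I (a \*: T);
  idl_mull : forall S T, A S -> I T -> I (S \o T);
  idl_mulr : forall S T, A S -> I T -> I (T \o S);
  idl_closed : A `&` norm_closure I `<=` I
}.

(* T_eps, given by its matrix. *)
Definition truncated_matrix (dot : {dot H for conjC}) (eps : R) T :
    X -> X -> H -> H :=
  fun x y => truncation dot eps (entry T x y).

Definition RANK M : X -> X -> nat := fun x y => rank (M x y).

Definition rank_ideal (dot : {dot H for conjC}) (D : set (X -> X -> nat)) :
    set (operator X H) :=
  [set T | roe_algebra T /\
    forall eps : R, 0 < eps -> D (RANK (truncated_matrix dot eps T))].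

End Operators.

Arguments roe_algebra {R} X H.

(* Main.v *)
Require Import Defs.
From HB Require Import structures.
From mathcomp Require Import all_boot all_order all_algebra.
From mathcomp Require Import sesquilinear.
From mathcomp Require Import all_classical all_reals all_analysis.
From mathcomp Require Import complex finmap ring lra.

Set Implicit Arguments.
Unset Strict Implicit.
Unset Printing Implicit Defensive.

Import Order.TTheory GRing.Theory Num.Def Num.Theory.
Import numFieldNormedType.Exports.

Local Open Scope classical_set_scope.
Local Open Scope ring_scope.
Local Open Scope complex_scope.

(** The truncation of a compact operator S at level eps has the smallest rank
    among all operators at distance less than eps from S, and it is itself at
    distance at most eps from S.  This is the minimax description of singular
    values: if an approximant G of rank k vanished on a nonzero combination of
    the right singular vectors whose singular value is at least eps, then S - G
    would expand that combination by eps; so there are at most k of these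
    vectors (rank_truncation_le), while the estimate for the truncation itself
    is Bessel's inequality (truncation_approximable).

    Membership of T in the ideal of D therefore means that, for every eps, the
    entries T(x, y) have approximants at uniform distance less than eps whose
    ranks are bounded by a member of D (rank_ideal_approximable and, conversely,
    rank_approximable_entry).  In this form nothing is left of the singular
    values, and the ideal properties follow from the axioms of D: approximants
    of a sum add up, a norm limit shares the approximants of a nearby operator,
    and for a product one replaces the factor in the Roe algebra by an operator
    S of propagation r.  An entry of the product is then a sum over a ball of
    radius r; bounded geometry bounds the number of its terms, hence its error,
    and the rank of its approximant is at most the value of E alpha or alpha E,
    with alpha the ranks of a truncation of T and E the entourage of pairs at
    distance at most r.

    The truncations are meaningful because the entries of operators of the Roe
    algebra have singular value decompositions (entry_svd).  These are built by
    maximizing the norm of S v over the unit vectors v orthogonal to the vectors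
    already chosen.  The maximum is attained by compactness and the
    parallelogram law (norm_attained), maximality makes the images orthogonal
    (extremal_image_orthogonal), and the norm of S on what remains tends to 0
    because orthogonal vectors of norm bounded below have no limit point
    (singular_value_decomposition). *)

(** * Real-valued norms *)

Section RealNorm.
Context {R : realType} {H : completeNormedModType R[i]}.
Implicit Types (h : H).

Lemma Re_norm_ge0 (a : R[i]) : 0 <= complex.Re `|a|.
Proof. by rewrite -(@lecR R) RRe_real ?normr_real ?rmorph0 ?normr_ge0. Qed.

Lemma rnorm_eq0 h : (rnorm h == 0) = (h == 0).
Proof. by rewrite -(inj_eq (@complexI R)) -rnormE normr_eq0. Qed.

Lemma rnormN h : rnorm (- h) = rnorm h.
Proof. by rewrite /rnorm normrN. Qed.

Lemma ler_rnormB (g h : H) : rnorm (g - h) <= rnorm g + rnorm h.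
Proof. by rewrite (le_trans (ler_rnormD _ _))// rnormN. Qed.

Lemma rnorm_le1 h : (`|h| <= 1) = (rnorm h <= 1).
Proof. by rewrite -(@lecR R) -rnormE. Qed.

Lemma rnorm_distC (g h : H) : rnorm (g - h) = rnorm (h - g).
Proof. by rewrite /rnorm distrC. Qed.

Lemma Re_norm_real (c : R) : 0 <= c -> complex.Re `|c%:C| = c.
Proof. by move=> c0; rewrite ger0_norm// lecR. Qed.

Lemma Re_norm_sqr (a : R[i]) : (complex.Re `|a| ^+ 2)%:C = a * conjC a.
Proof.
by rewrite -normCK rmorphXn; congr (_ ^+ 2); exact/RRe_real/normr_real.
Qed.

Lemma Re_norm_eq0 (a : R[i]) : complex.Re `|a| = 0 -> a = 0.
Proof.
move=> a0; have := Re_norm_sqr a; rewrite a0 expr0n => /esym/eqP.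
by rewrite mulf_eq0 conjC_eq0 orbb => /eqP.
Qed.

Lemma Re_normM_real (c : R) (a : R[i]) :
  0 <= c -> complex.Re `|c%:C * a| = c * complex.Re `|a|.
Proof.
move=> c0; rewrite normrM ger0_norm ?lecR//.
by case: (`|a|) => x y /=; rewrite mul0r subr0.
Qed.

Lemma conjC_real (c : R) : conjC c%:C = c%:C.
Proof. by rewrite -[LHS]/(conjc _)/= oppr0. Qed.

Lemma rnorm_double h : rnorm (h + h) = 2 * rnorm h.
Proof.
rewrite -mulr2n -scaler_nat (_ : 2 = 2%:C) ?rnormZ ?Re_norm_real//.
by rewrite rmorph_nat.
Qed.

End RealNorm.

(** * The norm of the square summable families *)

Section L2Norm.
Context {R : realType} {X : choiceType} {H : completeNormedModType R[i]}.
Implicit Types (f g : l2 X H) (h : H).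

Lemma l2norm_ge0 f : 0 <= l2norm f.
Proof. exact: sqrtr_ge0. Qed.

Lemma sqnorm_l2norm f : sqnorm f = (l2norm f ^+ 2)%:E.
Proof.
have := l2_valP f; rewrite inE => foo.
have f0 : (0 <= sqnorm f)%E by apply: esum_ge0 => x _; exact: sqnorm_pt_ge0.
rewrite /l2norm sqr_sqrtr ?fine_ge0// fineK// ge0_fin_numE//.
Qed.

Lemma sum_le_l2norm f (A : {fset X}) :
  \sum_(x <- A) rnorm (f x) ^+ 2 <= l2norm f ^+ 2.
Proof.
rewrite -lee_fin -sqnorm_l2norm -sumEFin.
by apply: ereal_sup_ubound; exists [set` A]; rewrite ?fsbig_finite ?set_fsetK.
Qed.

Lemma l2norm_le f (c : R) : 0 <= c ->
  (forall A : {fset X}, \sum_(x <- A) rnorm (f x) ^+ 2 <= c ^+ 2) ->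
  l2norm f <= c.
Proof.
move=> c0 fc; rewrite -ler_sqr ?nnegrE ?l2norm_ge0//.
rewrite -lee_fin -sqnorm_l2norm; apply: ge_ereal_sup => _ [A [finA _] <-].
by rewrite fsbig_finite//= sumEFin lee_fin fc.
Qed.

Lemma rnorm_le_l2norm f x : rnorm (f x) <= l2norm f.
Proof.
rewrite -ler_sqr ?nnegrE ?l2norm_ge0 ?rnorm_ge0//.
by have := @sum_le_l2norm f [fset x]%fset; rewrite big_seq_fset1.
Qed.

Lemma l2norm_eq0 f : l2norm f = 0 -> f = 0.
Proof.
move=> f0; apply: val_inj; apply/funext => x /=; apply/eqP.
by rewrite -rnorm_eq0 eq_le rnorm_ge0 andbT -f0 rnorm_le_l2norm.
Qed.

Lemma l2norm0 : l2norm (0 : l2 X H) = 0.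
Proof.
apply/eqP; rewrite eq_le l2norm_ge0 andbT; apply: l2norm_le => // A.
by rewrite big1 ?expr0n// => x _ /=; rewrite rnorm0 expr0n.
Qed.

Lemma l2norm_single (y : X) h : l2norm (single y h) = rnorm h.
Proof.
apply/eqP; rewrite eq_le; apply/andP; split; last first.
  by have := rnorm_le_l2norm (single y h) y; rewrite /= eqxx.
apply: l2norm_le => [|A]; first exact: rnorm_ge0.
have [yA|yA] := boolP (y \in A); last first.
  rewrite big_seq big1 ?sqr_ge0// => x Ax /=.
  by case: eqP => [xy|_]; [rewrite -xy Ax in yA|rewrite rnorm0 expr0n].
rewrite (bigD1_seq y)//= eqxx big1 ?addr0// => x /negPf ->.
by rewrite rnorm0 expr0n.
Qed.

Lemma l2normZ_le (a : R[i]) f : l2norm (a *: f) <= complex.Re `|a| * l2norm f.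
Proof.
have a0 := Re_norm_ge0 a.
apply: l2norm_le => [|A]; first exact: mulr_ge0 (l2norm_ge0 _).
rewrite exprMn; apply: le_trans (ler_wpM2l (sqr_ge0 _) (sum_le_l2norm f A)).
rewrite mulr_sumr//; apply: ler_sum => // x _ /=.
by rewrite rnormZ exprMn.
Qed.

(** Minkowski's inequality, from the weighted inequality
    (p + q)^2 <= (1 + b / a) p^2 + (1 + a / b) q^2, where a and b are the norms
    of the two summands. *)
Lemma l2normD f g : l2norm (f + g) <= l2norm f + l2norm g.
Proof.
have [/l2norm_eq0->|a0] := eqVneq (l2norm f) 0; first by rewrite l2norm0 !add0r.
have [/l2norm_eq0->|b0] := eqVneq (l2norm g) 0; first by rewrite l2norm0 !addr0.
apply: l2norm_le => [|A]; first by rewrite addr_ge0// l2norm_ge0.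
have := sum_le_l2norm f A; have := sum_le_l2norm g A.
have {a0} : 0 < l2norm f by rewrite lt0r a0 l2norm_ge0.
have {b0} : 0 < l2norm g by rewrite lt0r b0 l2norm_ge0.
move: (l2norm f) (l2norm g) => a b b0 a0 gb fa.
have -> : (a + b) ^+ 2 = (1 + b / a) * a ^+ 2 + (1 + a / b) * b ^+ 2.
  by field; rewrite !gt_eqF.
apply: le_trans (lerD _ _); last 2 first.
- by apply: ler_wpM2l fa; rewrite addr_ge0// divr_ge0// ltW.
- by apply: ler_wpM2l gb; rewrite addr_ge0// divr_ge0// ltW.
rewrite !mulr_sumr// -big_split//; apply: ler_sum => // x _ /=.
apply: (@le_trans _ _ ((rnorm (f x) + rnorm (g x)) ^+ 2)).
  by rewrite lerXn2r ?nnegrE ?addr_ge0 ?rnorm_ge0 ?ler_rnormD.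
move: (rnorm (f x)) (rnorm (g x)) => p q; rewrite -subr_ge0.
have -> : (1 + b / a) * p ^+ 2 + (1 + a / b) * q ^+ 2 - (p + q) ^+ 2
    = (b * p - a * q) ^+ 2 / (a * b) by field; rewrite !gt_eqF.
by rewrite divr_ge0 ?sqr_ge0// ltW// mulr_gt0.
Qed.

Lemma l2normN f : l2norm (- f) = l2norm f.
Proof.
suff leN g : l2norm (- g) <= l2norm g.
  by apply/eqP; rewrite eq_le leN -{1}[f]opprK leN.
rewrite -scaleN1r (le_trans (l2normZ_le _ _))//.
by rewrite normrN1 mul1r.
Qed.

Lemma l2normB f g : l2norm (f - g) <= l2norm f + l2norm g.
Proof. by rewrite (le_trans (l2normD _ _))// l2normN. Qed.

End L2Norm.

(** * Bounds on operators *)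

Section OperatorNorm.
Context {R : realType} {X : metricType R} {H : completeNormedModType R[i]}.
Implicit Types (S T : operator X H) (A : set (operator X H)).

(** Bounds in this form also make sense for unbounded maps, on which the supremum
    that defines opnorm takes a default value. *)
Definition op_bound (T : l2 X H -> l2 X H) (C : R) : Prop :=
  forall f, l2norm (T f) <= C * l2norm f.

Lemma op_bound_le (T : l2 X H -> l2 X H) (C C' : R) :
  C <= C' -> op_bound T C -> op_bound T C'.
Proof.
by move=> CC' TC f; apply: (le_trans (TC f)); rewrite ler_wpM2r ?l2norm_ge0.
Qed.

Lemma op_boundD (S T : l2 X H -> l2 X H) (C C' : R) :
  op_bound S C -> op_bound T C' -> op_bound (fun f => S f + T f) (C + C').
Proof.
by move=> SC TC f; rewrite (le_trans (l2normD _ _))// mulrDl lerD.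
Qed.

Lemma op_bound_comp (S T : l2 X H -> l2 X H) (C C' : R) : 0 <= C ->
  op_bound S C -> op_bound T C' -> op_bound (S \o T) (C * C').
Proof.
move=> C0 SC TC f; apply: (le_trans (SC _)).
by rewrite -mulrA ler_wpM2l.
Qed.

Lemma op_bound0 : op_bound (fun=> 0) 0.
Proof. by move=> f; rewrite l2norm0 mul0r. Qed.

Lemma op_boundZ (a : R[i]) (T : l2 X H -> l2 X H) (C : R) :
  op_bound T C -> op_bound (fun f => a *: T f) (complex.Re `|a| * C).
Proof.
move=> TC f; rewrite (le_trans (l2normZ_le _ _))// -mulrA.
by rewrite ler_wpM2l// Re_norm_ge0.
Qed.

Lemma bounded_operatorP T :
  bounded_operator T -> exists2 C : R, 0 < C & op_bound T C.
Proof.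
move=> [C TC]; exists (Order.max C 1); first by rewrite lt_max ltr01 orbT.
by apply: op_bound_le TC; rewrite le_max lexx.
Qed.

Lemma opnorm_le T (C : R) : 0 <= C -> op_bound T C -> opnorm T <= C.
Proof.
move=> C0 TC; apply: ge_sup => [|_ [f f1 <-]].
  by exists (l2norm (T 0)), 0 => //=; rewrite l2norm0.
by rewrite (le_trans (TC f))// ler_piMr.
Qed.

Lemma opnorm_ge T (C : R) : bounded_operator T -> opnorm T <= C -> op_bound T C.
Proof.
move=> [C' TC'] TC f.
have [->|f0] := eqVneq f 0; first by rewrite linear0 l2norm0 mulr0.
have {}f0 : 0 < l2norm f.
  by rewrite lt0r l2norm_ge0 andbT; apply: contra_neq f0; exact: l2norm_eq0.
pose g := (l2norm f)^-1%:C *: f.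
have Tg : l2norm (T g) <= C.
  apply: le_trans TC; apply: ub_le_sup.
    exists (Order.max C' 0) => _ [h /= h1 <-]; rewrite (le_trans (TC' h))//.
    rewrite (@le_trans _ _ (Order.max C' 0 * l2norm h))//.
      by rewrite ler_wpM2r ?l2norm_ge0// le_max lexx.
    by rewrite ler_piMr// le_max lexx orbT.
  exists g => //=; rewrite (le_trans (l2normZ_le _ _))//.
  rewrite Re_norm_real ?invr_ge0 ?(ltW f0)//.
  by rewrite mulVf ?gt_eqF.
have -> : T f = (l2norm f)%:C *: T g.
  by rewrite linearZ scalerA -rmorphM/= mulfV ?gt_eqF// scale1r.
rewrite (le_trans (l2normZ_le _ _))// Re_norm_real ?(ltW f0)// mulrC.
by rewrite ler_wpM2r// ltW.
Qed.

(** T = S + (T - S) is bounded as soon as it has one bounded approximant S. *)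
Lemma norm_closureP A T : A `<=` bounded_operator ->
  norm_closure A T <->
  forall eps : R, 0 < eps -> exists2 S, A S & op_bound (T \- S) eps.
Proof.
move=> Ab; split=> [[[C TC] TA] eps e0|TA].
  have [S AS TS] := TA _ e0; exists S => //; apply: opnorm_ge (ltW TS).
  have [C' SC'] := Ab _ AS; exists (C + C') => f /=.
  by rewrite (le_trans (l2normB _ _))// mulrDl lerD.
split=> [|eps e0].
  have [S AS TS] := TA _ ltr01; have [C SC] := Ab _ AS; exists (1 + C) => f.
  by rewrite -[T f](subrK (S f)); exact: (op_boundD TS SC).
have [S AS TS] := TA _ (divr_gt0 e0 (ltr0n _ 2)); exists S => //.
rewrite (@le_lt_trans _ _ (eps / 2))//; last first.
  by rewrite ltr_pdivrMr// ltr_pMr// ltr1n.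
by apply: opnorm_le => //; rewrite divr_ge0// ltW.
Qed.

End OperatorNorm.

(** * Compact operators *)

Section CompactOperators.
Context {R : realType} {H : completeNormedModType R[i]}.
Implicit Types (S T F : H -> H).

Lemma compact_precompact (A B : set H) : compact A -> B `<=` A -> precompact B.
Proof.
move=> cA BA; exists A => //; split=> //.
exact: compact_closed (@norm_hausdorff _ _) cA.
Qed.

Lemma compact_operator0 : compact_operator (fun=> 0 : H).
Proof.
apply: (@compact_precompact [set 0]); first exact: compact_set1.
by move=> _ [x _ <-].
Qed.

Lemma compact_operatorD S T :
  compact_operator S -> compact_operator T ->
  compact_operator (fun x => S x + T x).
Proof.
move=> [A SA [cA _]] [B TB [cB _]].
apply: compact_precompact (continuous_compact _ (compact_setX cA cB)) _.
  by apply: continuous_subspaceT; exact: add_continuous.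
move=> _ [x x1 <-]; exists (S x, T x) => //.
by split; [apply: SA; exists x|apply: TB; exists x].
Qed.

Lemma compact_operator_sum (I : Type) (r : seq I) (F : I -> H -> H) :
  (forall i, compact_operator (F i)) ->
  compact_operator (fun x => \sum_(i <- r) F i x).
Proof.
move=> cF; elim: r => [|i r IH].
  by under [X in compact_operator X]funext do rewrite big_nil;
     exact: compact_operator0.
under [X in compact_operator X]funext do rewrite big_cons.
exact: compact_operatorD.
Qed.

Lemma compact_operatorZ (a : R[i]) S :
  compact_operator S -> compact_operator (fun x => a *: S x).
Proof.
move=> [A SA [cA _]].
apply: compact_precompact (continuous_compact _ cA) _; last first.
  by move=> _ [x x1 <-]; exists (S x) => //; apply: SA; exists x.
by apply: continuous_subspaceT; exact: scaler_continuous.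
Qed.

(** S (T x) is C times the image under S of a vector of norm at most |x|. *)
Lemma compact_operator_comp (S : {linear H -> H}) T (C : R) : 0 < C ->
  compact_operator S -> (forall x, rnorm (T x) <= C * rnorm x) ->
  compact_operator (S \o T).
Proof.
move=> C0 /(compact_operatorZ C%:C) cS TC.
apply: precompact_subset cS => _ [x /= x1 <-].
exists (C^-1%:C *: T x) => /=; last first.
  by rewrite linearZ scalerA -rmorphM/= mulfV ?gt_eqF// scale1r.
rewrite normrZ ger0_norm ?lecR ?invr_ge0 ?(ltW C0)// rnormE -rmorphM/=.
rewrite (_ : 1 = 1%:C)// lecR ler_pdivrMl// (le_trans (TC x))//.
rewrite mulr1 ler_piMr//.
  exact: ltW.
by rewrite -lecR -rnormE.
Qed.

End CompactOperators.

(** * Bounded geometry *)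

Section BoundedGeometry.
Context {R : realType} {X : metricType R}.

Lemma bounded_geometry_balls (r : R) : bounded_geometry X ->
  exists N : nat, forall x : X, exists2 A : {fset X},
    (#|` A| <= N)%N & forall z, (z \in A) = (mdist x z <= r).
Proof.
move=> bgX; have r0 : 0 < Order.max r 0 + 1.
  by rewrite ltr_wpDl// le_max lexx orbT.
have [N ballN] := bgX _ r0; exists N => x.
have sub : [set z | mdist x z <= r] `<=` ball x (Order.max r 0 + 1).
  move=> z /= xz; rewrite ballEmdist/=.
  rewrite (le_lt_trans xz)// (@le_lt_trans _ _ (Order.max r 0)) ?ltrDl//.
  by rewrite le_max lexx.
have leN := card_le_trans (subset_card_le sub) (ballN x).
exists (fset_set [set z | mdist x z <= r]); first exact: geq_card_fset_set.
move=> z; rewrite in_fset_set; last by apply/finite_set_leP; exists N.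
by apply/idP/idP => [/set_mem|/mem_set].
Qed.

End BoundedGeometry.

(** * Matrix entries of operators *)

Section MatrixEntries.
Context {R : realType} {X : metricType R} {H : completeNormedModType R[i]}.
Implicit Types (S T : operator X H) (x y z : X) (h : H) (f : l2 X H).

Lemma l2_valD f g x : (f + g) x = f x + g x.
Proof. by []. Qed.

Lemma l2_valZ (a : R[i]) f x : (a *: f) x = a *: f x.
Proof. by []. Qed.

Lemma l2_valB f g x : (f - g) x = f x - g x.
Proof. by []. Qed.

Lemma entryD S T x y :
  entry (S \+ T) x y = fun h => entry S x y h + entry T x y h.
Proof. by apply/funext => h; exact: (l2_valD (S _) (T _)). Qed.

Lemma entryZ (a : R[i]) T x y :
  entry (a \*: T) x y = fun h => a *: entry T x y h.
Proof. by apply/funext => h; exact: (l2_valZ _ (T _)). Qed.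

Lemma single_is_linear (y : X) : linear (@single R X H y).
Proof.
move=> a h k; apply: val_inj; apply/funext => x /=.
rewrite /GRing.add/= /GRing.scale/=.
by case: eqP => // _; rewrite scaler0 addr0.
Qed.

Lemma entry_is_linear T x y : linear (entry T x y).
Proof.
by move=> a h k; rewrite /entry single_is_linear linearP.
Qed.

HB.instance Definition _ T x y :=
  GRing.isLinear.Build R[i] H H *:%R (entry T x y) (entry_is_linear T x y).

Lemma rnorm_entry T (C : R) x y h :
  op_bound T C -> rnorm (entry T x y h) <= C * rnorm h.
Proof.
by move=> TC; rewrite -(l2norm_single y h) (le_trans (rnorm_le_l2norm _ _)).
Qed.

Lemma rnorm_entryB S T (C : R) x y h : op_bound (T \- S) C ->
  rnorm (entry T x y h - entry S x y h) <= C * rnorm h.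
Proof.
move=> TSC; rewrite -(l2norm_single y h) -(l2_valB (T _) (S _)).
exact: le_trans (rnorm_le_l2norm _ _) (TSC _).
Qed.

Lemma l2_sum_single f (A : {fset X}) : (forall x, x \notin A -> f x = 0) ->
  f = \sum_(z <- A) single z (f z).
Proof.
move=> fA; apply: val_inj; apply/funext => x.
have -> : val (\sum_(z <- A) single z (f z)) x
    = \sum_(z <- A) (if x == z then f z else 0).
  elim/big_rec2 : _ => // z _ g _ <-; by [].
have [xA|xA] := boolP (x \in A).
  rewrite (bigD1_seq x)//= eqxx big1 ?addr0// => z.
  by rewrite eq_sym => /negPf ->.
rewrite [LHS]fA// big_seq big1// => z zA.
by case: eqP => // xz; rewrite xz zA in xA.
Qed.

(** The column of T at y has finite support, so that the linearity of S expands
    its value there as a finite sum over columns of S. *)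
Lemma entry_comp S T x y (A : {fset X}) :
  (forall z, z \notin A -> entry T z y = fun=> 0) ->
  forall h, entry (S \o T) x y h = \sum_(z <- A) entry S x z (entry T z y h).
Proof.
move=> TA h.
have TE : T (single y h) = \sum_(z <- A) single z (T (single y h) z).
  by apply: l2_sum_single => z /TA/(congr1 (fun F => F h)).
rewrite /entry /= [in LHS]TE.
rewrite linear_sum.
by elim/big_rec2 : _ => // z g _ _ <-.
Qed.

Lemma finite_propagationP T : finite_propagation T <->
  exists2 r : R, 0 <= r & forall x y, r < mdist x y -> entry T x y = fun=> 0.
Proof.
split=> [[r Tr]|[r r0 Tr]].
  exists (Order.max r 0); first by rewrite le_max lexx orbT.
  move=> x y; rewrite gt_max => /andP[rxy _]; apply: contrapT => /Tr/=.
  by rewrite leNgt rxy.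
exists r => x y /=; apply: contra_notP => /negP.
by rewrite -ltNge => /Tr.
Qed.

End MatrixEntries.

(** * Algebraic operations on the Roe algebra *)

Section RoeAlgebra.
Context {R : realType} {X : metricType R} {H : completeNormedModType R[i]}.
Implicit Types (S T : operator X H).

Lemma algebraic_roe_bounded :
  @algebraic_roe R X H `<=` @bounded_operator R X H.
Proof. by move=> T []. Qed.

Lemma algebraic_roe0 : @algebraic_roe R X H \0.
Proof.
split; first by exists 0; exact: op_bound0.
- by apply/finite_propagationP; exists 0.
- by move=> x y; exact: compact_operator0.
Qed.

Lemma algebraic_roeD S T :
  algebraic_roe S -> algebraic_roe T -> algebraic_roe (S \+ T).
Proof.
move=> [[C SC] /finite_propagationP[r r0 Sr] cS].
move=> [[C' TC] /finite_propagationP[r' r0' Tr] cT].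
split; first by exists (C + C'); exact: op_boundD.
- apply/finite_propagationP; exists (r + r'); first exact: addr_ge0.
  move=> x y rxy; apply/funext => h; rewrite entryD.
  rewrite Sr ?Tr ?addr0// (le_lt_trans _ rxy)// ?lerDl ?lerDr//.
- by move=> x y; rewrite entryD; exact: compact_operatorD.
Qed.

Lemma algebraic_roeZ (a : R[i]) T :
  algebraic_roe T -> algebraic_roe (a \*: T).
Proof.
move=> [[C TC] /finite_propagationP[r r0 Tr] cT].
split; first by exists (complex.Re `|a| * C); exact: op_boundZ.
- apply/finite_propagationP; exists r => // x y rxy.
  apply/funext => h; rewrite entryZ.
  by rewrite Tr// scaler0.
- by move=> x y; rewrite entryZ; exact: compact_operatorZ.
Qed.

Lemma algebraic_roe_comp S T : bounded_geometry X ->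
  algebraic_roe S -> algebraic_roe T -> algebraic_roe (S \o T).
Proof.
move=> bgX [/bounded_operatorP[C C0 SC] /finite_propagationP[r r0 Sr] cS].
move=> [/bounded_operatorP[C' C0' TC] /finite_propagationP[r' r0' Tr] cT].
have [N balls] := bounded_geometry_balls r' bgX.
have STE x y : exists2 A : {fset X}, (forall z, z \in A -> mdist z y <= r') &
  forall h, entry (S \o T) x y h = \sum_(z <- A) entry S x z (entry T z y h).
  have [A _ Ay] := balls y; exists A => [z|].
    by rewrite Ay metric_sym.
  apply: entry_comp => z; rewrite Ay -ltNge metric_sym; exact: Tr.
split; first by exists (C * C'); apply: op_bound_comp => //; exact: ltW.
- apply/finite_propagationP; exists (r + r'); first exact: addr_ge0.
  move=> x y rxy; apply/funext => h; have [A Ay ->] := STE x y.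
  rewrite big_seq big1// => z /Ay zy; rewrite Sr//.
  rewrite -(ltrD2r r') (lt_le_trans rxy)//.
  by rewrite (le_trans (metric_triangle x z y))// lerD2l.
- move=> x y; have [A _ /funext ->] := STE x y.
  apply: (@compact_operator_sum _ _ _ A
    (fun z => entry S x z \o entry T z y)) => z.
  by apply: (compact_operator_comp C0' (cS x z)) => h; exact: rnorm_entry.
Qed.

Lemma roe_algebraP T : roe_algebra X H T <->
  forall eps : R, 0 < eps ->
    exists2 S, algebraic_roe S & op_bound (T \- S) eps.
Proof. exact: norm_closureP algebraic_roe_bounded. Qed.

Lemma roe_algebra_bounded T :
  roe_algebra X H T -> exists2 C : R, 0 < C & op_bound T C.
Proof. by move=> [/bounded_operatorP]. Qed.

Lemma roe_algebra0 : roe_algebra X H \0.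
Proof.
apply/roe_algebraP => eps e0; exists \0; first exact: algebraic_roe0.
by move=> f /=; rewrite subrr l2norm0 mulr_ge0 ?l2norm_ge0 ?ltW.
Qed.

Lemma roe_algebraD S T :
  roe_algebra X H S -> roe_algebra X H T -> roe_algebra X H (S \+ T).
Proof.
move=> /roe_algebraP rS /roe_algebraP rT; apply/roe_algebraP => eps e0.
have [S' aS SS'] := rS _ (divr_gt0 e0 (ltr0n _ 2)).
have [T' aT TT'] := rT _ (divr_gt0 e0 (ltr0n _ 2)).
exists (S' \+ T'); first exact: algebraic_roeD.
move=> f /=; rewrite opprD addrACA [eps]splitr.
exact: (op_boundD SS' TT').
Qed.

Lemma roe_algebraZ (a : R[i]) T :
  roe_algebra X H T -> roe_algebra X H (a \*: T).
Proof.
move=> /roe_algebraP rT; apply/roe_algebraP => eps e0.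
have a1 : 0 < complex.Re `|a| + 1 by rewrite ltr_wpDl// Re_norm_ge0.
have [T' aT TT'] := rT _ (divr_gt0 e0 a1).
exists (a \*: T'); first exact: algebraic_roeZ.
move=> f /=; rewrite -scalerBr.
apply: (le_trans (op_boundZ a TT' f)).
rewrite ler_wpM2r ?l2norm_ge0// mulrCA ler_piMr ?(ltW e0)//.
by rewrite ler_pdivrMr// mul1r lerDl.
Qed.

(** ST - S'T' = (S - S')T + S'(T - T'), where T' is chosen after S' because the
    second error is multiplied by the norm of S'. *)
Lemma roe_algebra_comp S T : bounded_geometry X ->
  roe_algebra X H S -> roe_algebra X H T -> roe_algebra X H (S \o T).
Proof.
move=> bgX rS rT; apply/roe_algebraP => eps e0.
have [C C0 TC] := roe_algebra_bounded rT.
move/roe_algebraP : rS => rS; move/roe_algebraP : rT => rT.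
have e2 : 0 < eps / 2 by rewrite divr_gt0.
have [S' aS SS'] := rS _ (divr_gt0 e2 C0).
have [C' C0' SC'] := bounded_operatorP (algebraic_roe_bounded aS).
have [T' aT TT'] := rT _ (divr_gt0 e2 C0').
exists (S' \o T'); first exact: algebraic_roe_comp.
move=> f /=.
have -> : S (T f) - S' (T' f) = (S (T f) - S' (T f)) + S' (T f - T' f).
  by rewrite linearB addrA subrK.
rewrite (le_trans (l2normD _ _))// [eps]splitr mulrDl lerD//.
  have -> : eps / 2 * l2norm f = eps / 2 / C * (C * l2norm f).
    by field; rewrite gt_eqF.
  by rewrite (le_trans (SS' _))// ler_wpM2l// divr_ge0// ltW.
have -> : eps / 2 * l2norm f = C' * (eps / 2 / C' * l2norm f).
  by field; rewrite gt_eqF.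
by rewrite (le_trans (SC' _))// ler_wpM2l ?(ltW C0')//; exact: TT'.
Qed.

End RoeAlgebra.

(** * Orthonormal families *)

Section HilbertGeometry.
Context {R : realType} {H : completeNormedModType R[i]}.
Context {dot : {dot H for conjC}}.
Hypothesis dotN : induces_norm dot.
Implicit Types (x y z : H).

Lemma dot_rnorm x : dot x x = (rnorm x ^+ 2)%:C.
Proof. by rewrite dotN rnormE rmorphXn. Qed.

Lemma dotC x y : dot y x = conjC (dot x y).
Proof. by rewrite hermC expr0 mul1r. Qed.

Lemma dot_eq0C x y : dot x y = 0 -> dot y x = 0.
Proof. by move=> xy0; rewrite dotC xy0 rmorph0. Qed.

Lemma dotDl x y z : dot (x + y) z = dot x z + dot y z.
Proof. exact: linearDl. Qed.

Lemma dotBl x y z : dot (x - y) z = dot x z - dot y z.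
Proof. exact: linearBl. Qed.

Lemma dotZl (a : R[i]) x y : dot (a *: x) y = a * dot x y.
Proof. exact: linearZl_LR. Qed.

Lemma dotDr x y z : dot x (y + z) = dot x y + dot x z.
Proof. exact: linearDr. Qed.

Lemma dotZr (a : R[i]) x y : dot x (a *: y) = conjC a * dot x y.
Proof. by rewrite dotC dotZl rmorphM/= -dotC. Qed.

Lemma dot0l x : dot 0 x = 0.
Proof. exact: linear0l. Qed.

Lemma dot0r x : dot x 0 = 0.
Proof. exact: linear0r. Qed.

Lemma dot_suml (I : Type) (r : seq I) (a : I -> R[i]) (u : I -> H) y :
  dot (\sum_(i <- r) a i *: u i) y = \sum_(i <- r) a i * dot (u i) y.
Proof. by elim/big_rec2: _ => [|i c x _ <-]; rewrite ?dot0l// dotDl dotZl. Qed.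

Lemma pythagoras x y :
  dot x y = 0 -> rnorm (x + y) ^+ 2 = rnorm x ^+ 2 + rnorm y ^+ 2.
Proof.
move=> xy0; apply: (@complexI R); rewrite rmorphD/= -!dot_rnorm.
exact: hnormDd.
Qed.

Lemma parallelogram x y :
  rnorm (x + y) ^+ 2 + rnorm (x - y) ^+ 2 = 2 * (rnorm x ^+ 2 + rnorm y ^+ 2).
Proof.
apply: (@complexI R); rewrite rmorphM !rmorphD/= -!dot_rnorm.
rewrite [1%:C]rmorph1 hnormD hnormB; ring.
Qed.

Section OrthonormalFamily.
Context {I : eqType} {r : seq I} {u : I -> H}.
Hypothesis r_uniq : uniq r.
Hypothesis u_on : {in r &, forall i j, dot (u i) (u j) = (i == j)%:R}.

Lemma dot_sum_orthonormal (a : I -> R[i]) j : j \in r ->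
  dot (\sum_(i <- r) a i *: u i) (u j) = a j.
Proof.
move=> jr; rewrite dot_suml (bigD1_seq j)//= u_on// eqxx mulr1.
rewrite big_seq_cond big1 ?addr0// => i /andP[ir ij].
by rewrite u_on// (negPf ij) mulr0.
Qed.

Lemma rnorm_sum_orthonormal (a : I -> R[i]) :
  rnorm (\sum_(i <- r) a i *: u i) ^+ 2 = \sum_(i <- r) complex.Re `|a i| ^+ 2.
Proof.
apply: (@complexI R); rewrite -dot_rnorm {1}dot_suml rmorph_sum/=.
apply: eq_big_seq => i ir.
by rewrite dotC dot_sum_orthonormal// Re_norm_sqr.
Qed.

Lemma bessel x : \sum_(i <- r) complex.Re `|dot x (u i)| ^+ 2 <= rnorm x ^+ 2.
Proof.
rewrite -rnorm_sum_orthonormal; set y := \sum_(i <- r) _.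
rewrite -[x in leRHS](subrK y) pythagoras ?lerDr ?sqr_ge0//.
apply: dot_eq0C; rewrite dot_suml big_seq big1// => i ir.
rewrite (@dot_eq0C _ (u i)) ?mulr0// dotBl.
by rewrite (dot_sum_orthonormal (fun i => dot x (u i)))// subrr.
Qed.

End OrthonormalFamily.

Lemma cauchy_schwarz x y : complex.Re `|dot x y| <= rnorm x * rnorm y.
Proof.
have [->|y0] := eqVneq y 0; first by rewrite dot0r rnorm0 mulr0 normr0.
have {}y0 : 0 < rnorm y by rewrite lt0r rnorm_eq0 y0 rnorm_ge0.
pose u := (rnorm y)^-1%:C *: y.
have un : dot u u = 1.
  rewrite dot_rnorm rnormZ Re_norm_real ?invr_ge0 ?rnorm_ge0//.
  by rewrite mulVf ?gt_eqF// expr1n.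
have := @bessel _ [:: tt] (fun=> u) isT _ x; rewrite big_seq1.
have -> : dot x u = (rnorm y)^-1%:C * dot x y.
  by rewrite dotZr conjC_real.
rewrite Re_normM_real ?invr_ge0 ?rnorm_ge0//.
rewrite ler_sqr ?nnegrE ?mulr_ge0 ?invr_ge0 ?rnorm_ge0 ?Re_norm_ge0//.
rewrite ler_pdivrMl// mulrC; apply.
by move=> [] [] _ _; rewrite un.
Qed.

End HilbertGeometry.

(** * Compactness along ultrafilters *)

Section UltraCauchy.
Context {R : realType} {H : completeNormedModType R[i]}.
Implicit Types (S : H -> H) (F : set_system H).

(** The image under S of the unit ball is totally bounded.  In terms of
    ultrafilters this passes to norm limits by a three epsilon argument, and
    maximizing vectors can be handled without extracting subsequences. *)
Definition ultra_cauchy S : Prop :=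
  forall F, UltraFilter F -> F [set x | rnorm x <= 1] ->
  forall eps : R, 0 < eps ->
  exists2 A, F A & forall x y, A x -> A y -> rnorm (S x - S y) <= eps.

Lemma image_ultra (T U : Type) (f : T -> U) (F : set_system T) :
  UltraFilter F -> UltraFilter (f @ F).
Proof.
move=> FU; have FP : ProperFilter F by exact: ultra_proper.
split=> [|G GP FG]; first exact: fmap_proper_filter.
rewrite predeqE => A; split=> [GA|]; last exact: FG.
have [//|FA] := in_ultra_setVsetC (f @^-1` A) FU.
have : G (~` A) by apply: FG.
by move=> /(filterI GA); rewrite setICr => /filter_not_empty.
Qed.

Lemma compact_operator_ultra_cauchy S : compact_operator S -> ultra_cauchy S.
Proof.
move=> [A SA [cA _]] F FU F1 eps e0.
have SFU : UltraFilter (S @ F) by exact: image_ultra.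
have FP : ProperFilter F by exact: ultra_proper.
move: cA; rewrite compact_ultra => /(_ _ SFU).
case=> [|p [_ Fp]].
  suff : F (S @^-1` A) by [].
  apply: filterS F1 => x /= x1; apply: SA; exists x => //=.
  by rewrite rnorm_le1.
have e20 : 0 < (eps / 2)%:C :> R[i] by rewrite ltcR divr_gt0.
exists (S @^-1` ball p (eps / 2)%:C).
  by apply: Fp; exact: nbhsx_ballx.
have half x : ball p (eps / 2)%:C (S x) -> rnorm (S x - p) <= eps / 2.
  by rewrite -ball_normE/= rnormE ltcR rnorm_distC => /ltW.
move=> x y /= /half px /half py.
rewrite [eps]splitr (le_trans _ (lerD px py))//.
by rewrite (le_trans _ (ler_rnormB _ _))// opprB addrA subrK.
Qed.

Lemma ultra_cauchy_limit S :
  (forall eps : R, 0 < eps -> exists2 S', ultra_cauchy S' &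
    forall x, rnorm (S x - S' x) <= eps * rnorm x) ->
  ultra_cauchy S.
Proof.
move=> SS' F FU F1 eps e0.
have FP : ProperFilter F by exact: ultra_proper.
have e3 : 0 < eps / 3 by rewrite divr_gt0.
have [S' cS' {}SS'] := SS' _ e3.
have [A FA AS'] := cS' F FU F1 _ e3.
exists (A `&` [set x | rnorm x <= 1]); first exact: filterI.
have close x : rnorm x <= 1 -> rnorm (S x - S' x) <= eps / 3.
  by move=> x1; rewrite (le_trans (SS' x))// ler_piMr// ltW.
move=> x y [Ax /close x1] [Ay /close y1].
have := AS' _ _ Ax Ay.
have -> : S x - S y = (S x - S' x) + (S' x - S' y) - (S y - S' y).
  by rewrite opprB !addrA !subrK.
have := ler_rnormB ((S x - S' x) + (S' x - S' y)) (S y - S' y).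
have := ler_rnormD (S x - S' x) (S' x - S' y).
lra.
Qed.

End UltraCauchy.

(** * Singular value decompositions *)

Section SingularValues.
Context {R : realType} {H : completeNormedModType R[i]}.
Context {dot : {dot H for conjC}}.
Hypothesis dotN : induces_norm dot.
Context {S : {linear H -> H}} {C : R}.
Hypothesis S_bounded : forall x, rnorm (S x) <= C * rnorm x.
Hypothesis S_compact : ultra_cauchy S.

(** First-order condition at a maximum: with d the inner product of S v and S w,
    moving v in the direction s d w with s > 0 changes the square of the norm of
    the image by 2 s |d|^2 + O(s^2), and the square of the norm of v by O(s^2)
    only. *)
Lemma extremal_image_orthogonal (v w : H) : dot v w = 0 ->
  rnorm v = 1 ->
  (forall t : R[i],
    rnorm (S (v + t *: w)) <= rnorm (S v) * rnorm (v + t *: w)) ->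
  dot (S v) (S w) = 0.
Proof.
move=> vw0 v1 maxv; set d := dot (S v) (S w).
set m := rnorm (S v) in maxv *.
pose D := complex.Re `|d| ^+ 2.
pose K := m ^+ 2 * rnorm w ^+ 2.
have K0 : 0 <= K by rewrite mulr_ge0// sqr_ge0.
have perturb (s : R) : 0 <= s -> 2 * s * D <= s ^+ 2 * D * K.
  move=> s0; have := maxv (s%:C * d).
  rewrite -ler_sqr ?nnegrE ?mulr_ge0 ?rnorm_ge0//.
  have vtw : dot v ((s%:C * d) *: w) = 0 by rewrite dotZr vw0 mulr0.
  rewrite exprMn (pythagoras dotN vtw) v1.
  have -> : rnorm ((s%:C * d) *: w) ^+ 2 = s ^+ 2 * D * rnorm w ^+ 2.
    rewrite -scalerA rnormZ Re_norm_real// rnormZ.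
    by rewrite !exprMn /D mulrA.
  have -> : rnorm (S (v + (s%:C * d) *: w)) ^+ 2
      = m ^+ 2 + 2 * s * D + s ^+ 2 * D * rnorm (S w) ^+ 2.
    have cast (a c : R) : (a + 2 * s * D + s ^+ 2 * D * c)%:C
        = a%:C + s%:C * D%:C + s%:C * D%:C + s%:C * s%:C * D%:C * c%:C.
      by apply/eqP; rewrite eq_complex/=; apply/andP; split; apply/eqP; ring.
    apply: (@complexI R); rewrite cast -!(dot_rnorm dotN) Re_norm_sqr.
    rewrite linearD linearZ !(dotDl, dotDr, dotZl, dotZr).
    rewrite (dotC (S v) (S w)) -/d rmorphM/=.
    by rewrite conjC_real; ring.
  have := mulr_ge0 (mulr_ge0 (sqr_ge0 s) (sqr_ge0 (complex.Re `|d|)))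
    (sqr_ge0 (rnorm (S w))).
  rewrite -/D /K; nra.
have D0 : D = 0.
  apply/eqP; rewrite eq_le sqr_ge0 andbT leNgt; apply/negP => D0.
  have K1 : 0 < K + 1 by rewrite ltr_wpDl.
  (* this s makes s K < 1, against 2 <= s K *)
  have := perturb (K + 1)^-1; rewrite invr_ge0 ltW// => /(_ isT).
  have -> : 2 * (K + 1)^-1 * D = ((K + 1)^-1 ^+ 2 * D) * (2 * (K + 1)).
    by field; rewrite gt_eqF.
  rewrite ler_pM2l; last by rewrite mulr_gt0// exprn_gt0// invr_gt0.
  lra.
by apply: Re_norm_eq0; apply/eqP; rewrite -sqrf_eq0 -/D D0.
Qed.

(** Along an ultrafilter of almost maximizing vectors of the unit ball of V, the
    images S x and S y become close to each other.  Then S (x + y) has norm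
    almost 2 m, with m the supremum, so x + y has norm almost 2 and the
    parallelogram law makes x - y small: the ultrafilter is Cauchy, and its
    limit is maximizing. *)
Lemma norm_attained (V : set H) :
  V 0 -> (forall (t : R[i]) x y, V x -> V y -> V (t *: x + y)) ->
  (forall x, (forall eps : R, 0 < eps ->
    exists2 y, V y & rnorm (x - y) <= eps) -> V x) ->
  exists v, [/\ V v, v = 0 \/ rnorm v = 1 &
    forall w, V w -> rnorm (S w) <= rnorm (S v) * rnorm w].
Proof.
move=> V0 VP Vcl.
have VZ t x : V x -> V (t *: x) by move=> Vx; rewrite -[_ *: _]addr0; exact: VP.
have VD x y : V x -> V y -> V (x + y).
  by move=> Vx Vy; rewrite -[x]scale1r; exact: VP.
pose B := [set x | V x /\ rnorm x <= 1].
pose m := sup [set rnorm (S x) | x in B].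
have C0 : 0 <= Order.max C 0 by rewrite le_max lexx orbT.
have SC x : rnorm (S x) <= Order.max C 0 * rnorm x.
  by rewrite (le_trans (S_bounded x))// ler_wpM2r ?rnorm_ge0// le_max lexx.
have supB : has_sup [set rnorm (S x) | x in B].
  split; first by exists (rnorm (S 0)), 0 => //; split; rewrite ?rnorm0.
  exists (Order.max C 0) => _ [x [_ x1] <-].
  by rewrite (le_trans (SC x))// ler_piMr.
have m_ub x : B x -> rnorm (S x) <= m.
  by move=> Bx; apply: ub_le_sup; [exact: supB.2|exists x].
have m0 : 0 <= m.
  by rewrite (le_trans (rnorm_ge0 (S 0)))// m_ub//; split; rewrite ?rnorm0.
have mV w : V w -> rnorm (S w) <= m * rnorm w.
  move=> Vw; have [->|w0] := eqVneq w 0.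
    by rewrite linear0 rnorm0 mulr0.
  have {}w0 : 0 < rnorm w by rewrite lt0r rnorm_eq0 w0 rnorm_ge0.
  rewrite mulrC -ler_pdivrMl//.
  rewrite -[(rnorm w)^-1]Re_norm_real ?invr_ge0 ?rnorm_ge0// -rnormZ -linearZ.
  apply: m_ub; split; first exact: VZ.
  by rewrite rnormZ Re_norm_real ?invr_ge0 ?rnorm_ge0// mulVf ?gt_eqF.
have [m_eq0|m_neq0] := eqVneq m 0.
  (* V may be trivial, so a unit vector need not exist here *)
  exists 0; split=> //; first by left.
  by move=> w /mV; rewrite m_eq0 linear0 rnorm0.
have {m_neq0}m_gt0 : 0 < m by rewrite lt0r m_neq0.
pose A (d : R) := B `&` [set x | m - d < rnorm (S x)].
have A_filter : ProperFilter (filter_from [set d : R | 0 < d] A).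
  apply: filter_from_proper; last first.
    move=> d d0; have [_ [x Bx <-] mx] := sup_adherent d0 supB.
    by exists x.
  apply: filter_from_filter; first by exists 1 => /=.
  move=> d e d0 e0; exists (Order.min d e); first by rewrite /= lt_min d0.
  by move=> x [Bx /= mx]; split; split => //=; apply: le_lt_trans mx;
    rewrite lerD2l lerN2 ge_min lexx ?orbT.
have [F [FU AF]] := ultraFilterLemma A_filter.
have FP : ProperFilter F by exact: ultra_proper.
have FA d : 0 < d -> F (A d) by move=> d0; apply: AF; exists d.
have F1 : F [set x | rnorm x <= 1].
  by apply: filterS (FA 1 ltr01) => x [[]].
have Fcauchy (eps : R) : 0 < eps ->
    exists2 E, F E & forall x y, E x -> E y -> rnorm (x - y) < eps.
  move=> e0; pose eta := Order.min 1 (eps ^+ 2 / 8).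
  have eta0 : 0 < eta by rewrite lt_min ltr01 divr_gt0// exprn_gt0.
  have eta1 : eta <= 1 by rewrite ge_min lexx.
  have eta2 : eta <= eps ^+ 2 / 8 by rewrite ge_min lexx orbT.
  have me : 0 < m * eta / 3 by rewrite divr_gt0// mulr_gt0.
  have [E FE SE] := S_compact FU F1 me.
  exists (E `&` A (m * eta / 3)); first exact: filterI (FA _ me).
  move=> x y [Ex [[Vx x1] /= mx]] [Ey [[Vy y1] /= my]].
  have Sxy := SE _ _ Ex Ey.
  have big : 2 - eta <= rnorm (x + y).
    rewrite -(ler_pM2l m_gt0); apply: le_trans (mV _ (VD _ _ Vx Vy)).
    have := ler_rnormD (S (x + y)) (S x - S y).
    rewrite linearD addrACA subrr addr0 rnorm_double.
    move: Sxy mx; lra.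
  have := parallelogram dotN x y.
  rewrite -ltr_sqr ?nnegrE ?rnorm_ge0 ?(ltW e0)//.
  move: big x1 y1 eta1 eta2 eta0 (rnorm_ge0 x) (rnorm_ge0 y).
  move: (rnorm_ge0 (x + y)).
  move: (rnorm (x - y)) (rnorm (x + y)) (rnorm x) (rnorm y) => p q a b.
  move=> *.
  have a1 : a ^+ 2 <= 1 by rewrite expr_le1.
  have b1 : b ^+ 2 <= 1 by rewrite expr_le1.
  have q2 : (2 - eta) ^+ 2 <= q ^+ 2 by rewrite ler_sqr ?nnegrE//; lra.
  have e2 : 0 < eps ^+ 2 by rewrite exprn_gt0.
  nra.
have Fcvg : cvg F.
  apply/cauchy_cvgP/cauchy_exP => e e0.
  have [eR eE] : exists eR : R, e = eR%:C.
    by exists (complex.Re e); rewrite RRe_real// ger0_real// ltW.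
  move: e0; rewrite eE ltcR => eR0.
  have [E FE Exy] := Fcauchy _ eR0.
  have [x Ex] := filter_ex FE; exists x; apply: filterS FE => y Ey.
  by rewrite -ball_normE/= rnormE ltcR; exact: Exy.
pose v := lim F.
have near_v (d : R) : 0 < d -> exists2 x, A d x & rnorm (v - x) <= d.
  move=> d0; have : F (ball v d%:C).
    by apply: Fcvg; apply: nbhsx_ballx; rewrite ltcR.
  move=> /(filterI (FA d d0)) /filter_ex[x [Ax vx]]; exists x => //.
  by move: vx; rewrite -ball_normE/= rnormE ltcR => /ltW.
have Vv : V v by apply: Vcl => d /near_v[x [[Vx _] _] vx]; exists x.
have v1 : rnorm v <= 1.
  apply/ler_addgt0Pl => d /near_v[x [[_ x1] _] vx].
  by rewrite -[v](subrK x) (le_trans (ler_rnormD _ _))// lerD.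
have Sv : m <= rnorm (S v).
  apply/ler_addgt0Pl => d d0.
  have d'0 : 0 < d / (Order.max C 0 + 1) by rewrite divr_gt0// ltr_wpDl.
  have [x [_ /= mx] vx] := near_v _ d'0.
  have -> : d = (Order.max C 0 + 1) * (d / (Order.max C 0 + 1)).
    by field; rewrite gt_eqF// ltr_wpDl.
  have Sx : rnorm (S x) <= rnorm (S v) + rnorm (S (v - x)).
    by rewrite linearB -{1}[S x](subKr (S v)) ler_rnormB.
  have := SC (v - x); have := ler_wpM2l C0 vx.
  move: Sx mx; lra.
exists v; split=> //; last first.
  by move=> w /mV /le_trans; apply; rewrite ler_wpM2r ?rnorm_ge0.
right; apply/eqP; rewrite eq_le v1/= -(ler_pM2l m_gt0) mulr1.
by rewrite (le_trans Sv)// mV.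
Qed.


Definition orthogonal_to (vs : seq H) : set H :=
  [set x | forall i, (i < size vs)%N -> dot x vs`_i = 0].

Lemma extremal_vector (vs : seq H) : exists v,
  [/\ orthogonal_to vs v, v = 0 \/ rnorm v = 1 &
      forall w, orthogonal_to vs w -> rnorm (S w) <= rnorm (S v) * rnorm w].
Proof.
apply: norm_attained => [i _|t x y xvs yvs i ivs|x xvs i ivs].
- exact: dot0l.
- by rewrite dotDl dotZl xvs// yvs// mulr0 addr0.
- apply: Re_norm_eq0; apply/eqP; rewrite eq_le Re_norm_ge0 andbT.
  apply/ler_addgt0Pl => d d0; rewrite addr0.
  set u := vs`_i; have u1 : 0 < rnorm u + 1 by rewrite ltr_wpDl// rnorm_ge0.
  have [y yvs xy] := xvs _ (divr_gt0 d0 u1).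
  have -> : dot x u = dot (x - y) u by rewrite dotBl [dot y u]yvs// subr0.
  rewrite (le_trans (cauchy_schwarz dotN _ _))//.
  rewrite (le_trans (ler_wpM2r (rnorm_ge0 u) xy))//.
  by rewrite mulrAC ler_pdivrMr// ler_wpM2l ?(ltW d0)// lerDl.
Qed.

(** Each right singular vector is extremal on the orthogonal complement of the
    previous ones.  The singular values tend to 0 because the images S (v i) are
    pairwise orthogonal and cannot stay away from 0 in a totally bounded set.
    The n-th partial sum of the series is S (p n), with p n the projection of x
    to the span of v 0, ..., v (n - 1), and s n bounds S on the complement that
    contains the remainder x - p n. *)
Theorem singular_value_decomposition : exists s u v, is_svd dot S s u v.
Proof.
have [pick pickP] := choice extremal_vector.
pose vs := fix vs n :=
  if n is n'.+1 then rcons (vs n') (pick (vs n')) else [::].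
pose v n := pick (vs n).
have vsE n : vs n = [seq v i | i <- iota 0 n].
  by elim: n => // n IH; rewrite -[n.+1]addn1 iotaD map_cat -IH cats1 addn1.
have orthP n w :
    orthogonal_to (vs n) w <-> forall i, (i < n)%N -> dot w (v i) = 0.
  have nth_vs i : (i < n)%N -> (vs n)`_i = v i.
    by move=> ltin; rewrite vsE (nth_map 0%N) ?size_iota// nth_iota.
  have size_vs : size (vs n) = n by rewrite vsE size_map size_iota.
  split=> wn i.
    by move=> ltin; have := wn i; rewrite size_vs nth_vs//; exact.
  by rewrite size_vs => ltin; rewrite nth_vs// wn.
have v01 n : v n = 0 \/ rnorm (v n) = 1 by have [] := pickP (vs n).
have v_max n w : orthogonal_to (vs n) w ->
    rnorm (S w) <= rnorm (S (v n)) * rnorm w.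
  by have [_ _] := pickP (vs n); exact.
have v_orth i j : i != j -> dot (v i) (v j) = 0.
  have lt_orth k l : (k < l)%N -> dot (v l) (v k) = 0.
    by move=> ltkl; have [/orthP orth _ _] := pickP (vs l); exact: orth.
  rewrite neq_ltn => /orP[/lt_orth/dot_eq0C//|/lt_orth//].
pose s n := rnorm (S (v n)).
have v_unit n : s n != 0 -> rnorm (v n) = 1.
  by case: (v01 n) => // v0; rewrite /s v0 linear0 rnorm0 eqxx.
have Sv_orth i j : i != j -> dot (S (v i)) (S (v j)) = 0.
  suff lt_orth k l : (k < l)%N -> dot (S (v k)) (S (v l)) = 0.
    by rewrite neq_ltn => /orP[/lt_orth//|/lt_orth/dot_eq0C].
  move=> ltkl; have [/eqP|sk0] := eqVneq (s k) 0.
    by rewrite /s rnorm_eq0 => /eqP ->; exact: dot0l.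
  apply: extremal_image_orthogonal => [||t].
  - by apply: v_orth; rewrite ltn_eqF.
  - exact: v_unit.
  - apply: v_max; apply/orthP => e ltek.
    rewrite dotDl dotZl !v_orth ?mulr0 ?addr0// gtn_eqF//.
    exact: ltn_trans ltkl.
have s_ge0 n : 0 <= s n by exact: rnorm_ge0.
have s_le i j : (i <= j)%N -> s j <= s i.
  move=> leij; apply: le_trans (v_max i (v j) _) _.
    by apply/orthP => k ltki; rewrite v_orth// gtn_eqF// (leq_trans ltki).
  case: (v01 j) => ->; last by rewrite mulr1.
  by rewrite rnorm0 mulr0.
have v_le1 n : rnorm (v n) <= 1 by case: (v01 n) => ->; rewrite ?rnorm0.
have s_small (eps : R) : 0 < eps -> exists n, s n < eps.
  move=> e0; apply: contrapT => /forallNP s_big.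
  have {}s_big n : eps <= s n by rewrite leNgt; apply/negP.
  have [G [GU oG]] := @ultraFilterLemma _ (\oo : set_system nat) _.
  have GP : ProperFilter G by exact: ultra_proper.
  have vGU : UltraFilter (v @ G) by exact: image_ultra.
  have vG1 : (v @ G) [set x | rnorm x <= 1].
    by rewrite /= /fmap/=; apply: filterS filterT => n _ /=.
  have [E vGE SE] := S_compact vGU vG1 e0.
  have GE : G (v @^-1` E) by [].
  have [i Ei] := filter_ex GE.
  have Gi : G [set n | (i < n)%N] by apply: oG; exists i.+1.
  have [j [/= Ej ltij]] := filter_ex (filterI GE Gi).
  have := SE _ _ Ei Ej; rewrite leNgt => /negP; apply.
  rewrite -ltr_sqr ?nnegrE ?rnorm_ge0 ?(ltW e0)//.
  rewrite (pythagoras dotN); last first.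
    by rewrite -scaleN1r dotZr Sv_orth ?mulr0// ltn_eqF.
  rewrite rnormN -/(s i) -/(s j).
  have e2 : 0 < eps ^+ 2 by rewrite exprn_gt0.
  have si : eps ^+ 2 <= s i ^+ 2 by rewrite ler_sqr ?nnegrE// ltW.
  have sj : eps ^+ 2 <= s j ^+ 2 by rewrite ler_sqr ?nnegrE// ltW.
  lra.
(* when s n = 0 this is the zero vector, which the decomposition ignores *)
pose u n := (s n)^-1%:C *: S (v n).
exists s, u, v; split=> //.
- apply/cvgrPdist_lt => eps e0; have [N sN] := s_small _ e0.
  exists N => // n /= leNn; rewrite sub0r normrN ger0_norm//.
  exact: le_lt_trans (s_le _ _ leNn) sN.
- move=> i j si sj; rewrite /u dotZl dotZr.
  have [->|ij] := eqVneq i j; last by rewrite Sv_orth// !mulr0.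
  rewrite dot_rnorm// -/(s j) conjC_real -!rmorphM/=.
  by suff -> : (s j)^-1 * ((s j)^-1 * s j ^+ 2) = 1 by []; field.
- move=> i j si sj; have [->|ij] := eqVneq i j; last exact: v_orth.
  by rewrite dot_rnorm// v_unit// expr1n.
move=> x.
pose p n := \sum_(i <- iota 0 n) dot x (v i) *: v i.
have partial n : series (fun i => ((s i)%:C * dot x (v i)) *: u i) n = S (p n).
  rewrite /series/= /p linear_sum /index_iota subn0; apply: eq_bigr => i _.
  have -> : S (dot x (v i) *: v i) = dot x (v i) *: S (v i) by exact: linearZ.
  rewrite /u scalerA; have [si|si] := eqVneq (s i) 0.
    by move/eqP: (si); rewrite /s rnorm_eq0 => /eqP ->; rewrite !scaler0.
  by rewrite mulrAC -rmorphM mulfV// mul1r.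
have rest_orth n i : (i < n)%N -> dot (x - p n) (v i) = 0.
  move=> ltin; rewrite dotBl /p dot_suml (bigD1_seq i) ?iota_uniq ?mem_iota//=.
  rewrite big1 ?addr0; last by move=> j ji; rewrite v_orth// mulr0.
  rewrite dot_rnorm//; case: (v01 i) => [->|->].
    by rewrite dot0r mul0r subr0.
  by rewrite expr1n mulr1 subrr.
have rest_le n : rnorm (x - p n) <= rnorm x.
  rewrite -ler_sqr ?nnegrE ?rnorm_ge0//.
  suff po : dot (x - p n) (p n) = 0.
    by rewrite -{2}[x](subrK (p n)) (pythagoras dotN po) lerDl sqr_ge0.
  apply: dot_eq0C; rewrite /p dot_suml big_seq big1// => i.
  rewrite mem_iota => /andP[_ ltin].
  by rewrite (dot_eq0C (rest_orth n i ltin)) mulr0.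
apply/cvgrPdist_lt => e e0.
have [eR eE] : exists eR : R, e = eR%:C.
  by exists (complex.Re e); rewrite RRe_real// ger0_real// ltW.
move: e0; rewrite eE ltcR => eR0.
have x1 : 0 < rnorm x + 1 by rewrite ltr_wpDl// rnorm_ge0.
have [N sN] := s_small _ (divr_gt0 eR0 x1).
exists N => // n /= leNn; rewrite partial -linearB rnormE ltcR.
have /v_max : orthogonal_to (vs n) (x - p n).
  by apply/orthP => i; exact: rest_orth.
move=> /le_lt_trans; apply; rewrite -/(s n).
rewrite (@le_lt_trans _ _ (s n * (rnorm x + 1)))//.
  by rewrite ler_wpM2l// (le_trans (rest_le n))// lerDl.
by rewrite -ltr_pdivlMr// (le_lt_trans _ sN)// s_le.
Qed.

End SingularValues.

(** * Linear independence and rank *)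

Local Notation span := Defs.span.

Section SpanRank.
Context {R : realType} {H : completeNormedModType R[i]}.
Implicit Types (F G : H -> H).

(** Steinitz: more vectors than the size of a spanning family satisfy a linear
    relation, given by a nonzero row in the kernel of the matrix of their
    coordinates. *)
Lemma lin_indep_le n m (e : 'I_n -> H) (f : 'I_m -> H) :
  lin_indep e -> (forall i, span f (e i)) -> (n <= m)%N.
Proof.
move=> e_free /(_ _)/cid2-/all_sig2[a _ aE].
rewrite leqNgt; apply/negP => ltmn.
pose M : 'M[R[i]]_(n, m) := \matrix_(i, j) a i j.
have : kermx M != 0.
  by rewrite kermx_eq0 /row_free neq_ltn (leq_ltn_trans (rank_leq_col M)).
case/rowV0Pn => c /sub_kermxP cM; apply/negP; rewrite negbK.
apply/eqP/rowP => i; rewrite mxE; apply: e_free.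
under eq_bigr => j _ do rewrite -aE scaler_sumr.
rewrite exchange_big big1// => j _.
under eq_bigr => l _ do rewrite scalerA.
rewrite -scaler_suml; move/rowP: cM => /(_ j); rewrite !mxE => cMj.
have -> : \sum_l c 0 l * a l j = 0.
  by rewrite -[RHS]cMj; apply: eq_bigr => l _; rewrite mxE.
by rewrite scale0r.
Qed.

Lemma linear_combination G (I : Type) (r : seq I) (a : I -> R[i]) (v : I -> H) :
  linear G -> G (\sum_(i <- r) a i *: v i) = \sum_(i <- r) a i *: G (v i).
Proof.
move=> linG; elim: r => [|i r IH]; last by rewrite !big_cons linG IH.
have := linG (-1) 0 0; rewrite !big_nil scaler0 addr0 => ->.
by rewrite scaleN1r addNr.
Qed.

Definition range_in_span (k : nat) G : Prop :=
  exists g : 'I_k -> H, forall x, span g (G x).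

Lemma rank_span n (e : 'I_n -> H) F :
  lin_indep e -> span e = range F -> rank F = n.
Proof.
move=> e_free eF; have [] := @xgetPex _ 0%N
  [set n | exists2 e : 'I_n -> H, lin_indep e & span e = range F].
  by exists n, e.
rewrite -/(rank F) => e' e'_free e'F.
have span_mem k (g : 'I_k -> H) i : span g (g i).
  exists (fun j => (i == j)%:R) => //.
  rewrite (bigD1 i)//= eqxx scale1r big1 ?addr0// => j.
  by rewrite eq_sym => /negPf ->; rewrite scale0r.
apply/eqP; rewrite eqn_leq; apply/andP; split.
  by apply: (lin_indep_le (f := e) e'_free) => i; rewrite eF -e'F.
by apply: (lin_indep_le (f := e') e_free) => i; rewrite e'F -eF.
Qed.

Lemma range_in_span0 : range_in_span 0 (fun=> 0).
Proof.
exists (fun=> 0) => x; exists (fun=> 0) => //.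
by rewrite big_ord0.
Qed.

Lemma range_in_spanD k l F G : range_in_span k F -> range_in_span l G ->
  range_in_span (k + l) (fun x => F x + G x).
Proof.
move=> [f fF] [g gG].
exists (fun i => match fintype.split i with
                 | inl j => f j | inr j => g j end) => x.
have [a _ <-] := fF x; have [b _ <-] := gG x.
exists (fun i => match fintype.split i with
                 | inl j => a j | inr j => b j end) => //.
rewrite big_split_ord/=; congr (_ + _); apply: eq_bigr => i _.
  by rewrite (unsplitK (inl i)).
by rewrite (unsplitK (inr i)).
Qed.

Lemma range_in_span_compl k F G : linear F ->
  range_in_span k G -> range_in_span k (F \o G).
Proof.
move=> linF [g gG]; exists (F \o g) => x /=; have [a _ <-] := gG x.
by exists a => //; rewrite linear_combination.
Qed.

Lemma range_in_span_compr k (T : H -> H) G :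
  range_in_span k G -> range_in_span k (G \o T).
Proof. by move=> [g gG]; exists g => x; exact: gG. Qed.

End SpanRank.

(** * Truncations *)

Section Truncation.
Context {R : realType} {H : completeNormedModType R[i]}.
Context {dot : {dot H for conjC}}.
Hypothesis dotN : induces_norm dot.
Context {S : {linear H -> H}} {s : nat -> R} {u v : nat -> H}.
Hypothesis svdS : is_svd dot S s u v.
Context {eps : R}.
Hypothesis eps0 : 0 < eps.

Let term x i := ((s i)%:C * dot x (v i)) *: u i.

Let s_ge0 i : 0 <= s i. Proof. by case: svdS. Qed.

Lemma svd_limit_le x y (c : R) N : 0 <= c ->
  (forall n, (N <= n)%N -> rnorm (series (term x) n - y) <= c) ->
  rnorm (S x - y) <= c.
Proof.
move=> c0 yc; apply/ler_addgt0Pl => d d0.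
have [_ _ _ _ /(_ x)/cvgrPdist_lt/(_ d%:C)] := svdS.
rewrite ltcR => /(_ d0)[M _ SM].
have := SM (maxn M N) (leq_maxl _ _); rewrite rnormE ltcR => /ltW Sd.
have := yc _ (leq_maxr M N).
have -> : S x - y = (S x - series (term x) (maxn M N))
    + (series (term x) (maxn M N) - y) by rewrite addrA subrK.
by move=> yn; exact: le_trans (ler_rnormD _ _) (lerD Sd yn).
Qed.

Lemma svd_vector j : s j != 0 -> S (v j) = (s j)%:C *: u j.
Proof.
move=> sj; apply/eqP; rewrite -subr_eq0 -rnorm_eq0 eq_le rnorm_ge0 andbT.
apply: (svd_limit_le (N := j.+1)) => // n ltjn.
rewrite /series/= (bigD1_seq j) ?mem_index_iota ?iota_uniq//=.
have [_ _ _ vv _] := svdS.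
rewrite big1 => [|i ij].
  by rewrite addr0 /term vv// eqxx mulr1 subrr rnorm0.
rewrite /term; have [->|si] := eqVneq (s i) 0; first by rewrite mul0r scale0r.
by rewrite vv// eq_sym (negPf ij) mulr0 scale0r.
Qed.

Lemma large_singular_values : exists r : seq nat,
  uniq r /\ forall i, (i \in r) = (eps <= s i).
Proof.
have [_ /cvgrPdist_lt/(_ _ eps0)[N _ sN] _ _ _] := svdS.
exists [seq i <- iota 0 N | eps <= s i]; split.
  exact: filter_uniq (iota_uniq _ _).
move=> i; rewrite mem_filter mem_iota/= add0n.
have [//|/sN/=] := ltnP i N; first by rewrite andbT.
by rewrite sub0r normrN ger0_norm// andbF ltNge => /negPf.
Qed.

Section LargeValues.
Context {r : seq nat}.
Hypothesis r_uniq : uniq r.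
Hypothesis rE : forall i, (i \in r) = (eps <= s i).

Let r_gt0 i : i \in r -> 0 < s i.
Proof. by rewrite rE; exact: lt_le_trans. Qed.

Lemma large_left_orthonormal :
  {in r &, forall i j, dot (u i) (u j) = (i == j)%:R}.
Proof.
have [_ _ uu _ _] := svdS; move=> i j /r_gt0 si /r_gt0 sj.
by apply: uu; rewrite gt_eqF.
Qed.

Lemma large_right_orthonormal :
  {in r &, forall i j, dot (v i) (v j) = (i == j)%:R}.
Proof.
have [_ _ _ vv _] := svdS; move=> i j /r_gt0 si /r_gt0 sj.
by apply: vv; rewrite gt_eqF.
Qed.

Lemma svd_truncationE x :
  svd_truncation dot eps s u v x = \sum_(i <- r) term x i.
Proof.
have setE : [set i | eps <= s i] = [set` r].
  by apply/seteqP; split=> i /=; rewrite rE.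
by rewrite /svd_truncation setE (fsbig_seq _ (term x) r_uniq).
Qed.

(** The sum of the terms whose singular value is below eps has norm at most
    eps |x| by Bessel's inequality.  Those with singular value 0 are set apart
    since their vectors need not be orthonormal. *)
Lemma svd_truncation_error x :
  rnorm (S x - svd_truncation dot eps s u v x) <= eps * rnorm x.
Proof.
have er0 : 0 <= eps * rnorm x by rewrite mulr_ge0 ?rnorm_ge0 ?ltW.
apply: (svd_limit_le (N := (\max_(i <- r) i).+1)) => // n ltrn.
rewrite svd_truncationE /series/= /index_iota subn0.
pose small i := (s i < eps) && (s i != 0).
have -> : \sum_(i <- iota 0 n) term x i - \sum_(i <- r) term x i
    = \sum_(i <- [seq i <- iota 0 n | small i]) term x i.
  rewrite big_filter (bigID (fun i => i \in r))/=.
  have -> : \sum_(i <- iota 0 n | i \in r) term x i = \sum_(i <- r) term x i.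
    rewrite -big_filter; apply: perm_big; apply: uniq_perm => //.
      exact: filter_uniq (iota_uniq _ _).
    move=> i; rewrite mem_filter mem_iota/= add0n andb_idr// => ir.
    by apply: leq_trans ltrn; rewrite ltnS; exact: leq_bigmax_seq.
  rewrite addrAC subrr add0r (bigID (fun i => s i != 0))/=.
  rewrite [X in _ + X]big1 ?addr0; last first.
    by move=> i /andP[_ /negPn/eqP si]; rewrite /term si mul0r scale0r.
  by apply: eq_bigl => i; rewrite rE -ltNge.
set t := [seq i <- iota 0 n | small i].
have t_uniq : uniq t by exact: filter_uniq (iota_uniq _ _).
have tP i : i \in t -> s i < eps /\ s i != 0.
  by rewrite mem_filter => /andP[/andP[]].
rewrite -ler_sqr ?nnegrE ?rnorm_ge0//.
have [_ _ uu vv _] := svdS.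
have uut : {in t &, forall i j, dot (u i) (u j) = (i == j)%:R}.
  by move=> i j /tP[_ si] /tP[_ sj]; exact: uu.
have vvt : {in t &, forall i j, dot (v i) (v j) = (i == j)%:R}.
  by move=> i j /tP[_ si] /tP[_ sj]; exact: vv.
rewrite (rnorm_sum_orthonormal dotN t_uniq uut
  (fun i => (s i)%:C * dot x (v i))) exprMn.
apply: le_trans (ler_wpM2l (sqr_ge0 eps) (bessel dotN t_uniq vvt x)).
rewrite mulr_sumr big_seq [leRHS]big_seq; apply: ler_sum => i /tP[si _].
rewrite Re_normM_real// exprMn ler_wpM2r ?sqr_ge0//.
by rewrite ler_sqr ?nnegrE// ltW.
Qed.

Let nth_r (i : 'I_(size r)) : nth 0%N r i \in r. Proof. exact: mem_nth. Qed.

Let sum_r (b : nat -> H) :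
  \sum_(i < size r) b (nth 0%N r i) = \sum_(i <- r) b i.
Proof. by rewrite [RHS](big_nth 0%N) big_mkord. Qed.

Let extend_r (a : 'I_(size r) -> R[i]) : exists b : nat -> R[i],
  forall i : 'I_(size r), b (nth 0%N r i) = a i.
Proof.
exists (fun j => if insub (index j r) is Some i then a i else 0) => i.
by rewrite index_uniq// valK.
Qed.

Lemma rank_svd_truncation : rank (svd_truncation dot eps s u v) = size r.
Proof.
pose e (i : 'I_(size r)) := u (nth 0%N r i).
apply: (@rank_span _ _ _ e).
  move=> a; have [b bE] := extend_r a => a0 i; rewrite -bE.
  rewrite -(dot_sum_orthonormal r_uniq large_left_orthonormal b (nth_r i)).
  rewrite -(sum_r (fun j => b j *: u j)).
  under eq_bigr do rewrite bE.
  by rewrite a0 dot0l.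
apply/seteqP; split=> [_ [a _ <-]|_ [x _ <-]]; last first.
  exists (fun i : 'I_(size r) =>
    (s (nth 0%N r i))%:C * dot x (v (nth 0%N r i))) => //.
  by rewrite (sum_r (term x)) -svd_truncationE.
have [b bE] := extend_r a.
exists (\sum_(i <- r) (b i / (s i)%:C) *: v i) => //.
rewrite svd_truncationE.
rewrite -(eq_bigr _ (fun i _ => congr1 (fun c => c *: e i) (bE i))).
rewrite (sum_r (fun j => b j *: u j)); apply: eq_big_seq => i ir.
rewrite /term (dot_sum_orthonormal r_uniq large_right_orthonormal)//.
by rewrite mulrC divfK// gt_eqF// ltcR r_gt0.
Qed.

Lemma svd_truncation_span :
  range_in_span (size r) (svd_truncation dot eps s u v).
Proof.
exists (fun i => u (nth 0%N r i)) => x.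
exists (fun i : 'I_(size r) =>
    (s (nth 0%N r i))%:C * dot x (v (nth 0%N r i))) => //.
by rewrite (sum_r (term x)) -svd_truncationE.
Qed.

Lemma svd_truncation_linear : linear (svd_truncation dot eps s u v).
Proof.
move=> a x y; rewrite !svd_truncationE scaler_sumr -big_split.
apply: eq_bigr => i _.
by rewrite /term/= dotDl dotZl mulrDr scalerDl scalerA mulrCA.
Qed.

Lemma large_lower_bound (a : nat -> R[i]) :
  eps * rnorm (\sum_(i <- r) a i *: v i)
    <= rnorm (S (\sum_(i <- r) a i *: v i)).
Proof.
have -> : S (\sum_(i <- r) a i *: v i) = \sum_(i <- r) (a i * (s i)%:C) *: u i.
  rewrite linear_sum; apply: eq_big_seq => i /r_gt0 si.
  rewrite linearZ/= svd_vector ?gt_eqF//; exact: scalerA.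
rewrite -ler_sqr ?nnegrE ?mulr_ge0 ?rnorm_ge0 ?(ltW eps0)// exprMn.
rewrite (rnorm_sum_orthonormal dotN r_uniq large_left_orthonormal).
rewrite (rnorm_sum_orthonormal dotN r_uniq large_right_orthonormal).
rewrite mulr_sumr big_seq [leRHS]big_seq; apply: ler_sum => i.
rewrite rE => si.
rewrite [a i * _]mulrC Re_normM_real// exprMn ler_wpM2r ?sqr_ge0//.
by rewrite ler_sqr ?nnegrE// ltW.
Qed.

(** The vectors G (v i), for the singular values s i that are at least eps, are
    linearly independent: a combination w of the v i with G w = 0 satisfies
    eps |w| <= |S w| = |S w - G w| <= delta |w|. *)
Lemma large_count_le k (G : H -> H) (delta : R) :
  linear G -> delta < eps -> (forall x, rnorm (S x - G x) <= delta * rnorm x) ->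
  range_in_span k G -> (size r <= k)%N.
Proof.
move=> linG de SG [g gG].
pose e (i : 'I_(size r)) := G (v (nth 0%N r i)).
apply: (@lin_indep_le _ _ _ _ e g) => [a|i]; last exact: gG.
have [b bE] := extend_r a => a0 i.
pose w := \sum_(i <- r) b i *: v i.
have Gw : G w = 0.
  rewrite /w linear_combination// -(sum_r (fun j => b j *: G (v j))) -[RHS]a0.
  by apply: eq_bigr => j _; rewrite bE.
have w0 : w = 0.
  apply/eqP; rewrite -rnorm_eq0 eq_le rnorm_ge0 andbT leNgt; apply/negP => w0.
  have := SG w; rewrite Gw subr0 => /(le_trans (large_lower_bound b)).
  by rewrite ler_pM2r// leNgt de.
rewrite -bE -(dot_sum_orthonormal r_uniq large_right_orthonormal b (nth_r i)).
by rewrite -/w w0 dot0l.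
Qed.

End LargeValues.
End Truncation.

(** * Approximation by operators of small rank *)

Section ApproximationByRank.
Context {R : realType} {H : completeNormedModType R[i]}.
Implicit Types (S T G : H -> H) (k l : nat) (delta : R).

(** For a compact S this says that its (k + 1)-st singular value is at most
    delta. *)
Definition rank_approximable k delta S : Prop :=
  exists G, [/\ linear G, range_in_span k G &
    forall h, rnorm (S h - G h) <= delta * rnorm h].

Lemma rank_approximable0 : rank_approximable 0 0 (fun=> 0).
Proof.
exists (fun=> 0); split=> [a x y||h].
- by rewrite scaler0 addr0.
- exact: range_in_span0.
- by rewrite subrr rnorm0 mul0r.
Qed.

Lemma rank_approximable_le k delta delta' S :
  delta <= delta' ->
  rank_approximable k delta S -> rank_approximable k delta' S.
Proof.
move=> dd' [G [linG Gk SG]]; exists G; split=> // h.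
by rewrite (le_trans (SG h))// ler_wpM2r ?rnorm_ge0.
Qed.

Lemma rank_approximable_near k delta delta' S S' :
  (forall h, rnorm (S h - S' h) <= delta' * rnorm h) ->
  rank_approximable k delta S' -> rank_approximable k (delta' + delta) S.
Proof.
move=> SS' [G [linG Gk S'G]]; exists G; split=> // h.
have -> : S h - G h = (S h - S' h) + (S' h - G h) by rewrite addrA subrK.
by rewrite mulrDl (le_trans (ler_rnormD _ _))// lerD.
Qed.

Lemma rank_approximableD k l delta delta' S T :
  rank_approximable k delta S -> rank_approximable l delta' T ->
  rank_approximable (k + l) (delta + delta') (fun h => S h + T h).
Proof.
move=> [F [linF Fk SF]] [G [linG Gl TG]].
exists (fun h => F h + G h); split=> [a x y||h].
- by rewrite linF linG scalerDr addrACA.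
- exact: range_in_spanD.
- by rewrite opprD addrACA mulrDl (le_trans (ler_rnormD _ _))// lerD.
Qed.

Lemma rank_approximable_sum (I : Type) (r : seq I) (k : I -> nat) delta
    (S : I -> H -> H) :
  (forall i, rank_approximable (k i) delta (S i)) ->
  rank_approximable (\sum_(i <- r) k i) ((size r)%:R * delta)
    (fun h => \sum_(i <- r) S i h).
Proof.
move=> kS; elim: r => [|i r IH].
  rewrite big_nil mul0r.
  under [X in rank_approximable _ _ X]funext do rewrite big_nil.
  exact: rank_approximable0.
rewrite big_cons /= -natr1 mulrDl mul1r addrC.
under [X in rank_approximable _ _ X]funext do rewrite big_cons.
exact: rank_approximableD.
Qed.

Lemma rank_approximable_compl k delta (C : R) S T : linear S -> 0 <= C ->
  (forall h, rnorm (S h) <= C * rnorm h) ->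
  rank_approximable k delta T -> rank_approximable k (C * delta) (S \o T).
Proof.
move=> linS C0 SC [G [linG Gk TG]]; exists (S \o G); split=> [a x y||h].
- by rewrite /= linG linS.
- exact: range_in_span_compl.
- have -> : (S \o T) h - (S \o G) h = S (T h - G h).
    by rewrite /= addrC -scaleN1r -linS scaleN1r addrC.
  by rewrite (le_trans (SC _))// -mulrA ler_wpM2l.
Qed.

Lemma rank_approximable_compr k delta (C : R) S T : linear T -> 0 <= delta ->
  (forall h, rnorm (T h) <= C * rnorm h) ->
  rank_approximable k delta S -> rank_approximable k (delta * C) (S \o T).
Proof.
move=> linT d0 TC [G [linG Gk SG]]; exists (G \o T); split=> [a x y||h].
- by rewrite /= linT linG.
- exact: range_in_span_compr.
- by rewrite (le_trans (SG _))// -mulrA ler_wpM2l.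
Qed.

Lemma rank_approximableZ k delta (a : R[i]) S :
  rank_approximable k delta S ->
  rank_approximable k (complex.Re `|a| * delta) (fun h => a *: S h).
Proof.
apply: (@rank_approximable_compl _ _ _ ( *:%R a)) => [b x y||h].
- by rewrite scalerDr !scalerA mulrC.
- exact: Re_norm_ge0.
- by rewrite rnormZ.
Qed.

Context {dot : {dot H for conjC}}.
Hypothesis dotN : induces_norm dot.

Lemma truncation_svd (S : {linear H -> H}) (eps : R) :
  (exists s u v, is_svd dot S s u v) ->
  exists s u v, is_svd dot S s u v /\
    truncation dot eps S = svd_truncation dot eps s u v.
Proof.
move=> [s [u [v svdS]]].
apply: (@xgetPex _ (fun=> 0) [set F | exists s u v, is_svd dot S s u v /\
                                   F = svd_truncation dot eps s u v]).
by exists (svd_truncation dot eps s u v), s, u, v.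
Qed.

Lemma rank_truncation_le (S : {linear H -> H}) k delta (eps : R) : 0 < eps ->
  (exists s u v, is_svd dot S s u v) ->
  rank_approximable k delta S -> delta < eps ->
  (rank (truncation dot eps S) <= k)%N.
Proof.
move=> e0 /(truncation_svd eps)[s [u [v [svdS ->]]]] [G [linG Gk SG]] de.
have [r [r_uniq rE]] := large_singular_values svdS e0.
rewrite (rank_svd_truncation svdS e0 r_uniq rE).
exact: (large_count_le dotN svdS e0 r_uniq rE linG de SG Gk).
Qed.

Lemma truncation_approximable (S : {linear H -> H}) (eps : R) : 0 < eps ->
  (exists s u v, is_svd dot S s u v) ->
  rank_approximable (rank (truncation dot eps S)) eps S.
Proof.
move=> e0 /(truncation_svd eps)[s [u [v [svdS ->]]]].
have [r [r_uniq rE]] := large_singular_values svdS e0.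
exists (svd_truncation dot eps s u v); split.
- exact: svd_truncation_linear r_uniq rE.
- rewrite (rank_svd_truncation svdS e0 r_uniq rE).
  exact: svd_truncation_span r_uniq rE.
- move=> h; exact: (svd_truncation_error dotN svdS e0 r_uniq rE).
Qed.

End ApproximationByRank.

(** * Sums over an entourage *)

Section EntourageSums.
Context {R : realType} {X : metricType R}.
Implicit Types (alpha : X -> X -> nat) (r : R).

Lemma coarse_entourage_ball r :
  coarse_entourage [set p : X * X | mdist p.1 p.2 <= r].
Proof. by exists r. Qed.

Lemma entourage_mull_ball r alpha x y (A : {fset X}) :
  (forall z, (z \in A) = (mdist x z <= r)) ->
  entourage_mull [set p | mdist p.1 p.2 <= r] alpha x y
    = (\sum_(z <- A) alpha z y)%N.
Proof.
move=> AE; rewrite /entourage_mull (fsbigTE A) => [|z]; last first.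
  by rewrite AE => xz; rewrite memNset ?mul0n//=; apply/negP.
by apply: eq_big_seq => z; rewrite AE => xz; rewrite mem_set ?mul1n.
Qed.

Lemma entourage_mulr_ball r alpha x y (A : {fset X}) :
  (forall z, (z \in A) = (mdist y z <= r)) ->
  entourage_mulr alpha [set p | mdist p.1 p.2 <= r] x y
    = (\sum_(z <- A) alpha x z)%N.
Proof.
move=> AE; rewrite /entourage_mulr (fsbigTE A) => [|z]; last first.
  by rewrite AE metric_sym => yz; rewrite memNset ?muln0//=; apply/negP.
by apply: eq_big_seq => z; rewrite AE metric_sym => yz; rewrite mem_set ?muln1.
Qed.

End EntourageSums.

Section ProductEntries.
Context {R : realType} {X : metricType R} {H : completeNormedModType R[i]}.
Implicit Types (S T : operator X H).

(** When only S has small propagation, the middle index can be taken near the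
    row instead of near the column. *)
Lemma entry_comp_row S T x y (A B : {fset X}) :
  (forall z, z \notin B -> entry T z y = fun=> 0) ->
  (forall z, z \notin A -> entry S x z = fun=> 0) ->
  forall h, entry (S \o T) x y h = \sum_(z <- A) entry S x z (entry T z y h).
Proof.
move=> TB SA h; rewrite (entry_comp S x TB).
rewrite (@big_fset_incl _ _ _ _ B (A `|` B)%fset) ?fsubsetUr//; last first.
  by move=> z _ /TB ->; rewrite linear0.
rewrite [RHS](@big_fset_incl _ _ _ _ A (A `|` B)%fset) ?fsubsetUl//.
by move=> z _ /SA ->.
Qed.

End ProductEntries.

(** * The ideal of a rank distribution *)

Section RankIdeal.
Context {R : realType} {X : metricType R} {H : completeNormedModType R[i]}.
Context {dot : {dot H for conjC}} {D : set (X -> X -> nat)}.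
Hypothesis dotN : induces_norm dot.
Hypothesis bgX : bounded_geometry X.
Hypothesis rdD : rank_distribution D.
Implicit Types (S T : operator X H).

Lemma entry_svd T x y : roe_algebra X H T ->
  exists s u v, is_svd dot (entry T x y) s u v.
Proof.
move=> roeT; have [C C0 TC] := roe_algebra_bounded roeT.
apply: (singular_value_decomposition dotN (C := C)) => [h|].
  exact: rnorm_entry.
apply: ultra_cauchy_limit => eps e0; move/roe_algebraP : roeT => /(_ _ e0).
case=> S [_ _ cS] TS; exists (entry S x y).
  exact: compact_operator_ultra_cauchy.
by move=> h; exact: rnorm_entryB.
Qed.

Lemma rank_approximable_entry T x y (eps : R) : 0 < eps -> roe_algebra X H T ->
  rank_approximable (RANK (truncated_matrix dot eps T) x y) eps (entry T x y).
Proof.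
by move=> e0 roeT; exact: truncation_approximable (entry_svd x y roeT).
Qed.

Lemma rank_approximable_op_bound S T x y k (delta delta' : R) :
  op_bound (T \- S) delta' -> rank_approximable k delta (entry S x y) ->
  rank_approximable k (delta' + delta) (entry T x y).
Proof.
move=> TS; apply: rank_approximable_near => h.
exact: rnorm_entryB.
Qed.

(** This reduces membership in the ideal to approximations, which combine freely
    under the algebraic operations, whereas truncations do not. *)
Lemma rank_ideal_approximable T : roe_algebra X H T ->
  (forall eps : R, 0 < eps -> exists beta delta, [/\ D beta, delta < eps &
    forall x y, rank_approximable (beta x y) delta (entry T x y)]) ->
  rank_ideal dot D T.
Proof.
move=> roeT approxT; split=> // eps e0.
have [beta [delta [Db de bT]]] := approxT _ e0.
have le_beta x y : (RANK (truncated_matrix dot eps T) x y <= beta x y)%N.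
  exact: (rank_truncation_le dotN e0 (entry_svd x y roeT) (bT x y) de).
apply: (rkd_le rdD _ Db le_beta).
have [r betar] := rkd_rank_function rdD Db; exists r => x y xy; apply: betar.
by apply: contra_neq xy => /= b0; apply/eqP; rewrite -leqn0 -b0 le_beta.
Qed.

Lemma rank_ideal0 : rank_ideal dot D (\0 : operator X H).
Proof.
apply: rank_ideal_approximable; first exact: roe_algebra0.
move=> eps e0; exists (fun _ _ => 0%N), 0; split=> //.
  have supp0 : rank_supp (fun _ _ : X => 0%N) = set0.
    by apply/seteqP; split=> p //=; rewrite /rank_supp/= eqxx.
  apply: (rkd_finite rdD); last by rewrite supp0.
  by exists 0 => x y; rewrite supp0.
by move=> x y; exact: rank_approximable0.
Qed.

Lemma rank_idealD S T :
  rank_ideal dot D S -> rank_ideal dot D T -> rank_ideal dot D (S \+ T).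
Proof.
move=> [roeS DS] [roeT DT].
apply: rank_ideal_approximable; first exact: roe_algebraD.
move=> eps e0; have e3 : 0 < eps / 3 by rewrite divr_gt0.
exists (fun x y => RANK (truncated_matrix dot (eps / 3) S) x y
  + RANK (truncated_matrix dot (eps / 3) T) x y)%N, (eps / 3 + eps / 3).
split=> [||x y]; [exact: (rkd_add rdD) (DS _ e3) (DT _ e3)|lra|].
rewrite entryD; apply: rank_approximableD; exact: rank_approximable_entry.
Qed.

Lemma rank_idealZ (a : R[i]) T :
  rank_ideal dot D T -> rank_ideal dot D (a \*: T).
Proof.
move=> [roeT DT]; apply: rank_ideal_approximable; first exact: roe_algebraZ.
move=> eps e0.
have a1 : 0 < complex.Re `|a| + 1 by rewrite ltr_wpDl// Re_norm_ge0.
have ea : 0 < eps / (complex.Re `|a| + 1) by rewrite divr_gt0.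
exists (RANK (truncated_matrix dot (eps / (complex.Re `|a| + 1)) T)).
exists (complex.Re `|a| * (eps / (complex.Re `|a| + 1))).
split=> [||x y]; first exact: DT.
  by rewrite mulrA ltr_pdivrMr// mulrC ltr_pM2l// ltrDl.
by rewrite entryZ; apply: rank_approximableZ; exact: rank_approximable_entry.
Qed.

(** With S' of finite propagation close to S, the entry of T S' at (x, y) is a
    sum over the points z of a ball around y, and T(x, z) is replaced by its
    truncation at eta.  The bound N on the number of points is replaced by N + 1
    because it is a denominator in eta. *)
Lemma rank_ideal_mulr S T :
  roe_algebra X H S -> rank_ideal dot D T -> rank_ideal dot D (T \o S).
Proof.
move=> roeS [roeT DT].
apply: rank_ideal_approximable; first exact: roe_algebra_comp.
move=> eps e0; have [C C0 TC] := roe_algebra_bounded roeT.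
have e4C : 0 < eps / 4 / C by rewrite !divr_gt0.
move/roe_algebraP : roeS => /(_ _ e4C)[S' algS' SS'].
have [C' C0' SC'] := bounded_operatorP (algebraic_roe_bounded algS').
have [_ /finite_propagationP[r r0 S'r] _] := algS'.
have [N balls] := bounded_geometry_balls r bgX.
have CN0 : 0 < 4 * C' * N.+1%:R by rewrite !mulr_gt0.
pose eta := eps / (4 * C' * N.+1%:R).
have eta0 : 0 < eta by rewrite divr_gt0.
exists (entourage_mulr (RANK (truncated_matrix dot eta T))
  [set p | mdist p.1 p.2 <= r]), (eps / 4 + eps / 4).
split=> [||x y]; [|lra|].
  exact: (rkd_mulr rdD) (coarse_entourage_ball r) (DT _ eta0).
apply: (@rank_approximable_op_bound (T \o S')).
  move=> f /=; rewrite -linearB; apply: le_trans (TC _) _.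
  have -> : eps / 4 * l2norm f = C * (eps / 4 / C * l2norm f).
    by field; rewrite gt_eqF.
  by rewrite ler_wpM2l ?(ltW C0)//; exact: SS'.
have [A AN AE] := balls y; rewrite (entourage_mulr_ball _ _ AE).
have TS'E : entry (T \o S') x y
    = fun h => \sum_(z <- A) (entry T x z \o entry S' z y) h.
  apply/funext; apply: entry_comp => z; rewrite AE -ltNge metric_sym.
  exact: S'r.
rewrite TS'E.
have sumA := @rank_approximable_sum _ _ _ A _ (eta * C') _ (fun z =>
  rank_approximable_compr (entry_is_linear S' z y) (ltW eta0)
    (fun h => rnorm_entry z y h SC') (rank_approximable_entry x z eta0 roeT)).
apply: rank_approximable_le sumA.
apply: (@le_trans _ _ (N.+1%:R * (eta * C'))).
  have etaC' : 0 <= eta * C' by rewrite mulr_ge0// ltW.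
  by rewrite ler_wpM2r// ler_nat ltnW.
suff -> : N.+1%:R * (eta * C') = eps / 4 by [].
rewrite /eta; move: (N.+1%:R : R) (ltr0Sn R N) => n n0.
by field; rewrite !gt_eqF.
Qed.

(** Here T must be replaced as well, by an operator T' of finite propagation,
    for the columns to which S' is applied to have finite support.  The
    propagation of T' depends on eta, but the number of terms only on that of
    S': the sum is taken over a ball around x, so that eta can be chosen before
    T'. *)
Lemma rank_ideal_mull S T :
  roe_algebra X H S -> rank_ideal dot D T -> rank_ideal dot D (S \o T).
Proof.
move=> roeS [roeT DT].
apply: rank_ideal_approximable; first exact: roe_algebra_comp.
move=> eps e0; have [C C0 TC] := roe_algebra_bounded roeT.
have e4C : 0 < eps / 4 / C by rewrite !divr_gt0.
move/roe_algebraP : roeS => /(_ _ e4C)[S' algS' SS'].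
have [C' C0' SC'] := bounded_operatorP (algebraic_roe_bounded algS').
have [_ /finite_propagationP[r r0 S'r] _] := algS'.
have [N balls] := bounded_geometry_balls r bgX.
have CN0 : 0 < 8 * C' * N.+1%:R by rewrite !mulr_gt0.
pose eta := eps / (8 * C' * N.+1%:R).
have eta0 : 0 < eta by rewrite divr_gt0.
have [T' algT' TT'] := (roe_algebraP T).1 roeT _ eta0.
have [_ /finite_propagationP[r' r0' T'r'] _] := algT'.
have [N' balls'] := bounded_geometry_balls r' bgX.
have C'eta : C' * eta * N.+1%:R = eps / 8.
  rewrite /eta; move: (N.+1%:R : R) (ltr0Sn R N) => n n0.
  by field; rewrite !gt_eqF.
have C'eta_le : C' * eta <= eps / 8.
  have C'eta0 : 0 <= C' * eta by rewrite mulr_ge0// ltW.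
  by rewrite -C'eta ler_peMr// ler1n.
exists (entourage_mull [set p | mdist p.1 p.2 <= r]
  (RANK (truncated_matrix dot eta T))), ((eps / 4 + C' * eta) + eps / 4).
split=> [||x y]; [|lra|].
  exact: (rkd_mull rdD) (coarse_entourage_ball r) (DT _ eta0).
apply: (@rank_approximable_op_bound (S' \o T')).
  move=> f /=.
  have -> : S (T f) - S' (T' f) = (S (T f) - S' (T f)) + S' (T f - T' f).
    by rewrite linearB addrA subrK.
  rewrite (le_trans (l2normD _ _))// mulrDl lerD//.
    have -> : eps / 4 * l2norm f = eps / 4 / C * (C * l2norm f).
      by field; rewrite gt_eqF.
    by rewrite (le_trans (SS' _))// ler_wpM2l// ltW.
  by rewrite (le_trans (SC' _))// -mulrA ler_wpM2l ?(ltW C0')//; exact: TT'.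
have [A AN AE] := balls x; have [B _ BE] := balls' y.
rewrite (entourage_mull_ball _ _ AE).
have STE : entry (S' \o T') x y
    = fun h => \sum_(z <- A) (entry S' x z \o entry T' z y) h.
  apply/funext; apply: (@entry_comp_row _ _ _ _ _ _ _ A B) => z.
    by rewrite BE -ltNge metric_sym; exact: T'r'.
  by rewrite AE -ltNge; exact: S'r.
rewrite STE.
have T'approx z : rank_approximable
    (RANK (truncated_matrix dot eta T) z y) (eta + eta) (entry T' z y).
  apply: rank_approximable_op_bound (rank_approximable_entry z y eta0 roeT).
  by move=> f /=; rewrite -opprB l2normN; exact: TT'.
have sumA := @rank_approximable_sum _ _ _ A _ (C' * (eta + eta)) _ (fun z =>
  rank_approximable_compl (entry_is_linear S' x z) (ltW C0')
    (fun h => rnorm_entry x z h SC') (T'approx z)).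
apply: rank_approximable_le sumA.
apply: (@le_trans _ _ (N.+1%:R * (C' * (eta + eta)))); last lra.
have C'eta2 : 0 <= C' * (eta + eta) by rewrite mulr_ge0 ?addr_ge0// ltW.
by rewrite ler_wpM2r// ler_nat ltnW.
Qed.

Lemma rank_ideal_closed T : norm_closure (rank_ideal dot D) T ->
  roe_algebra X H T -> rank_ideal dot D T.
Proof.
have bounded : rank_ideal dot D `<=` @bounded_operator R X H by move=> S [[]].
move=> /(norm_closureP _ bounded) closT roeT.
apply: rank_ideal_approximable => //.
move=> eps e0; have e3 : 0 < eps / 3 by rewrite divr_gt0.
have [S [roeS DS] TS] := closT _ e3.
exists (RANK (truncated_matrix dot (eps / 3) S)), (eps / 3 + eps / 3).
split=> [||x y]; [exact: DS|lra|].
by apply: rank_approximable_op_bound TS _; exact: rank_approximable_entry.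
Qed.

End RankIdeal.

Theorem lemma4p2 (R : realType) (X : metricType R)
    (H : completeNormedModType R[i]) (dot : {dot H for Num.conj})
    (D : set (X -> X -> nat)) :
  induces_norm dot -> separable H -> infinite_dimensional H ->
  (forall x : X, open [set x]) -> bounded_geometry X ->
  rank_distribution D ->
  closed_ideal (roe_algebra X H) (rank_ideal dot D).
Proof.
move=> dotN _ _ _ bgX rdD; split.
- by move=> T [].
- exact: rank_ideal0.
- exact: rank_idealD.
- exact: rank_idealZ.
- exact: rank_ideal_mull.
- exact: rank_ideal_mulr.
- by move=> T [roeT closT]; exact: rank_ideal_closed closT roeT.
Qed.
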